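(* Let $F$ be a field of characteristic $\neq 2$, let $Q$ be a quaternion algebra over $F$, let $0\neq\alpha\in F$, and let $\mathbb{O}=(Q,\alpha)$ be the corresponding octonion algebra. Assume Property P: for all $a_1,a_2\in Q$ the element $\|a_1\|-\alpha\|a_2\|$ is a square in $F$. Let $V\subset\mathbb{O}$ be the space of pure octonions. Let $p\in F\{x_1,\dots,x_n\}$ be a multilinear nonassociative polynomial, and let $\operatorname{Im} p=\{p(a_1,\dots,a_n): a_1,\dots,a_n\in\mathbb{O}\}$. Then $\operatorname{Im} p$ is one of $\{0\}$, $F$, $V$, $\mathbb{O}$ (where $F$ is identified with $F\cdot 1\subset\mathbb{O}$).
   Context: Quaternion algebra: a 4-dimensional associative unital $F$-algebra $Q=F+Fx+Fy+Fxy$ with $x^2,y^2\in F\setminus\{0\}$ and $xy=-yx$, with its standard involution $*$ (fixing $F$ and sending $x,y,xy$ to their negatives). The norm on $Q$ is $\|a\|=a^*a\in F$. Octonion algebra: $\mathbb{O}=(Q,\alpha)$ is the vector space $Q\oplus Q$ with multiplication $(a_1,a_2)(b_1,b_2)=(a_1b_1+\alpha b_2^*a_2,\; b_2a_1+a_2b_1^* )$ and involution $(a_1,a_2)^*=(a_1^*,-a_2)$. Its unit is $(1,0)$. The trace is $\operatorname{tr}(a)=\frac12(a+a^* )\in F$ and the norm is $\|a\|=aa^*\in F$, so $\|(a_1,a_2)\|=\|a_1\|-\alpha\|a_2\|$. A pure octonion is an element of trace $0$; $V$ is the set of all pure octonions. $F\{x_1,\dots,x_n\}$ is the free nonassociative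 algebra over $F$: finite $F$-linear combinations of (nonempty) nonassociative words in $x_1,\dots,x_n$. A polynomial $p\in F\{x_1,\dots,x_n\}$ is multilinear if every variable $x_1,\dots,x_n$ occurs exactly once in each of its monomials ($n\ge 1$). *)

(* Defs.v *)
From HB Require Import structures.
From mathcomp Require Import all_boot all_order all_algebra all_field.
From mathcomp Require Import finmap.
From mathcomp.multinomials Require Import monalg.

Set Implicit Arguments.
Unset Strict Implicit.
Unset Printing Implicit Defensive.

Import GRing.Theory.
Local Open Scope ring_scope.

Section Quaternion.
Context {F : fieldType} {Q : falgType F}.

Definition qseq (x y : Q) : 4.-tuple Q := [tuple 1; x; y; x * y].

Definition quaternion_algebra (x y : Q) : Prop :=
  [/\ \dim {:Q} = 4%N,
      <<qseq x y>>%VS = fullv,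
      exists2 a : F, a != 0 & x * x = a%:A,
      exists2 b : F, b != 0 & y * y = b%:A
    & x * y = - (y * x)].

Definition qconj (x y q : Q) : Q :=
  let c i := coord (qseq x y) (inord i) q in
  (c 0%N)%:A - c 1%N *: x - c 2%N *: y - c 3%N *: (x * y).

(* The norm of q is kept as an element of Q, lying on the line F * 1. *)
Definition qnorm (x y q : Q) : Q := qconj x y q * q.

End Quaternion.

(* Octonion multiplication is omul below, never the componentwise product that
   the library puts on Q * Q; only the vector space structure is reused. *)
Definition oct (F : fieldType) (Q : falgType F) : Type := (Q * Q)%type.
HB.instance Definition _ (F : fieldType) (Q : falgType F) :=
  GRing.Lmodule.copy (oct Q) (Q * Q)%type.

Section Octonion.
Context {F : fieldType} {Q : falgType F}.
Variables (x y : Q) (alpha : F).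

Definition oone : oct Q := (1, 0).

Definition omul (a b : oct Q) : oct Q :=
  (a.1 * b.1 + alpha *: (qconj x y b.2 * a.2),
   b.2 * a.1 + a.2 * qconj x y b.1).

Definition oconj (a : oct Q) : oct Q := (qconj x y a.1, - a.2).

Definition otr (a : oct Q) : oct Q := 2%:R^-1 *: (a + oconj a).

Definition ozero (a : oct Q) : Prop := a = 0.
Definition oscalar (a : oct Q) : Prop := exists c : F, a = c *: oone.
Definition opure (a : oct Q) : Prop := otr a = 0.
Definition ofull (_ : oct Q) : Prop := True.

Definition propertyP : Prop :=
  forall a1 a2 : Q, exists c : F,
    qnorm x y a1 - alpha *: qnorm x y a2 = (c ^+ 2)%:A.

End Octonion.

Inductive word (n : nat) : Type :=
  | WVar of 'I_n
  | WMul of word n & word n.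

Section Word.
Variable n : nat.

Fixpoint word_tree (w : word n) : GenTree.tree 'I_n :=
  match w with
  | WVar i => GenTree.Leaf i
  | WMul u v => GenTree.Node 0 [:: word_tree u; word_tree v]
  end.

Fixpoint tree_word (t : GenTree.tree 'I_n) : option (word n) :=
  match t with
  | GenTree.Leaf i => Some (WVar i)
  | GenTree.Node _ [:: t1; t2] =>
      if tree_word t1 is Some u then
        if tree_word t2 is Some v then Some (WMul u v) else None
      else None
  | _ => None
  end.

Lemma word_treeK : pcancel word_tree tree_word.
Proof. by elim=> //= u -> v ->. Qed.

HB.instance Definition _ := Countable.copy (word n) (pcan_type word_treeK).

Fixpoint occ (i : 'I_n) (w : word n) : nat :=
  match w with
  | WVar j => (i == j)
  | WMul u v => occ i u + occ i v
  end.

End Word.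

(* F{x_1, ..., x_n}: finitely supported functions from words to F. *)
Definition napoly (F : fieldType) (n : nat) := {malg F[word n]}.

Definition multilinear (F : fieldType) (n : nat) (p : napoly F n) : Prop :=
  forall w : word n, w \in msupp p -> forall i : 'I_n, occ i w = 1%N.

Section Evaluation.
Context {F : fieldType} {Q : falgType F}.
Variables (x y : Q) (alpha : F) (n : nat).

Fixpoint weval (a : 'I_n -> oct Q) (w : word n) : oct Q :=
  match w with
  | WVar i => a i
  | WMul u v => omul x y alpha (weval a u) (weval a v)
  end.

Definition peval (p : napoly F n) (a : 'I_n -> oct Q) : oct Q :=
  \sum_(w <- msupp p) p@_w *: weval a w.

Definition Im_poly (p : napoly F n) (b : oct Q) : Prop :=
  exists a : 'I_n -> oct Q, peval p a = b.

End Evaluation.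

Definition same_set (T : Type) (A B : T -> Prop) : Prop :=
  forall t : T, A t <-> B t.

(* Main.v *)
Require Import Defs.
From mathcomp Require Import all_boot all_order all_algebra all_field.
From mathcomp Require Import ring finmap.
From mathcomp.multinomials Require Import monalg.

Set Implicit Arguments.
Unset Strict Implicit.
Unset Printing Implicit Defensive.

Import GRing.Theory.
Local Open Scope ring_scope.

(** By Property P the numbers -x^2, -y^2 and -alpha are squares, so the algebra
    is the standard octonion algebra, with orthonormal basis of eight units, and
    the norm, the sum of the squares of the eight coordinates, is always a
    square. All the work is done in the standard algebra on F^8.

    Two facts about the octonions are used. First, two nonzero pure octonions
    with the same norm are conjugate under an automorphism ([pure_conj]): any
    two orthonormal pure vectors u, w complete to a frame 1, u, w, uw, z, ..., whose
    multiplication table is the standard one ([frame_aut]). Hence the image of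
    p is stable under scaling and under replacing a nonzero pure part by any
    other nonzero pure octonion of the same norm. Secondly, the eight
    units are homogeneous for a grading by (Z/2)^3. So p takes, on a tuple of
    units, a multiple of one unit, which is a scalar or pure.

    If all values on units vanish then p = 0 on the algebra; if they are all
    scalars the image is F. If some value on units is pure and nonzero then,
    after scaling, every pure octonion of nonzero norm is attained. A nonzero
    pure octonion of norm 0 exists only if -1 = i^2 in F; then the eigenspaces
    of left multiplication by the first imaginary unit give a grading by Z/3 in
    which the pieces of degree 1 and 2 consist of pure octonions of norm 0. Not
    all values of p lie in the piece of degree 0, and homogeneous arguments
    yield a nonzero value in one of the two others ([attained_nilpotent]). So
    all pure octonions are attained, and the image is V when the values on units
    are all pure.

    There remains the case where both scalar and pure nonzero values occur on
    units. Take two tuples of units e, e' with values of the two kinds, at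
    minimal Hamming distance. Every tuple that mixes their entries has value 0,
    hence if all but one of the differing entries are replaced by e_j + e'_j, p
    becomes a linear function of the remaining entry whose values contain both
    p(e) and p(e') ([closest_pencil]). Thus the image contains a
    plane spanned by 1 and a unit, and so all octonions whose pure part has
    nonzero norm. If there are nonzero isotropic pure octonions, then F is
    quadratically closed, hence infinite. The same minimality argument for two
    tuples with pure values of different degrees gives a slot in which the pure
    parts of the values span a nondegenerate plane; moving the other entries
    along a line towards a tuple where p has nonzero trace gives a pencil of
    values that also has elements of nonzero trace. The norm of the pure part
    is then a nondegenerate binary quadratic form on that pencil; it has two zeros, and the trace vanishes at one of them at most
    ([parabolic_in_pencil]). *)

(** * The standard octonions: all structure constants equal to -1 *)

Section StandardQuaternions.
Variable F : fieldType.
Implicit Types p q : 'rV[F]_4.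

Definition q4 (a0 a1 a2 a3 : F) : 'rV[F]_4 := \row_k [:: a0; a1; a2; a3]`_k.

Definition qco p (k : nat) : F := p 0 (inord k).

Lemma q4_eta p : p = q4 (qco p 0) (qco p 1) (qco p 2) (qco p 3).
Proof.
apply/rowP=> k; rewrite mxE /qco.
case: k => [[|[|[|[|m]]]] Hm] //=; congr (p _ _); apply: val_inj;
  by rewrite /= inordK.
Qed.

Variant q4_spec : 'rV[F]_4 -> Type :=
  Q4Spec a0 a1 a2 a3 : q4_spec (q4 a0 a1 a2 a3).

Lemma q4P p : q4_spec p.
Proof. by rewrite (q4_eta p). Qed.

Lemma qco_q4 a0 a1 a2 a3 :
  (qco (q4 a0 a1 a2 a3) 0 = a0) * (qco (q4 a0 a1 a2 a3) 1 = a1) *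
  (qco (q4 a0 a1 a2 a3) 2 = a2) * (qco (q4 a0 a1 a2 a3) 3 = a3).
Proof. by rewrite /qco !mxE !inordK. Qed.

Lemma q4D a0 a1 a2 a3 b0 b1 b2 b3 :
  q4 a0 a1 a2 a3 + q4 b0 b1 b2 b3 = q4 (a0 + b0) (a1 + b1) (a2 + b2) (a3 + b3).
Proof. by apply/rowP=> k; rewrite !mxE; case: k => [[|[|[|[|m]]]] Hm]. Qed.

Lemma q4N a0 a1 a2 a3 : - q4 a0 a1 a2 a3 = q4 (- a0) (- a1) (- a2) (- a3).
Proof. by apply/rowP=> k; rewrite !mxE; case: k => [[|[|[|[|m]]]] Hm]. Qed.

Lemma q4Z c a0 a1 a2 a3 :
  c *: q4 a0 a1 a2 a3 = q4 (c * a0) (c * a1) (c * a2) (c * a3).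
Proof. by apply/rowP=> k; rewrite !mxE; case: k => [[|[|[|[|m]]]] Hm]. Qed.

Lemma q4_inj a0 a1 a2 a3 b0 b1 b2 b3 :
  q4 a0 a1 a2 a3 = q4 b0 b1 b2 b3 -> [/\ a0 = b0, a1 = b1, a2 = b2 & a3 = b3].
Proof.
move=> ab; split; [have := congr1 (qco^~ 0%N) ab | have := congr1 (qco^~ 1%N) ab |
  have := congr1 (qco^~ 2%N) ab | have := congr1 (qco^~ 3%N) ab];
  by rewrite !qco_q4.
Qed.

Lemma q4_0 : 0 = q4 0 0 0 0.
Proof. by apply/rowP=> k; rewrite !mxE; case: k => [[|[|[|[|m]]]] Hm]. Qed.

Definition qmul p q : 'rV[F]_4 :=
  let x := qco p in let y := qco q in
  q4 (x 0 * y 0 - x 1 * y 1 - x 2 * y 2 - x 3 * y 3)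
     (x 0 * y 1 + x 1 * y 0 + x 2 * y 3 - x 3 * y 2)
     (x 0 * y 2 - x 1 * y 3 + x 2 * y 0 + x 3 * y 1)
     (x 0 * y 3 + x 1 * y 2 - x 2 * y 1 + x 3 * y 0).

Definition qbar p : 'rV[F]_4 :=
  q4 (qco p 0) (- qco p 1) (- qco p 2) (- qco p 3).

Definition qdot p q : F :=
  qco p 0 * qco q 0 + qco p 1 * qco q 1 + qco p 2 * qco q 2 + qco p 3 * qco q 3.

Lemma qmul_q4 a0 a1 a2 a3 b0 b1 b2 b3 :
  qmul (q4 a0 a1 a2 a3) (q4 b0 b1 b2 b3) =
  q4 (a0 * b0 - a1 * b1 - a2 * b2 - a3 * b3)
     (a0 * b1 + a1 * b0 + a2 * b3 - a3 * b2)
     (a0 * b2 - a1 * b3 + a2 * b0 + a3 * b1)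
     (a0 * b3 + a1 * b2 - a2 * b1 + a3 * b0).
Proof. by rewrite /qmul !qco_q4. Qed.

Lemma qbar_q4 a0 a1 a2 a3 : qbar (q4 a0 a1 a2 a3) = q4 a0 (- a1) (- a2) (- a3).
Proof. by rewrite /qbar !qco_q4. Qed.

Lemma qdot_q4 a0 a1 a2 a3 b0 b1 b2 b3 :
  qdot (q4 a0 a1 a2 a3) (q4 b0 b1 b2 b3) =
  a0 * b0 + a1 * b1 + a2 * b2 + a3 * b3.
Proof. by rewrite /qdot !qco_q4. Qed.

Definition q4E := (qmul_q4, qbar_q4, qdot_q4, q4D, q4N, q4Z).

End StandardQuaternions.

Section StandardOctonions.
Variable F : fieldType.
Local Notation E := 'rV[F]_(4 + 4).
Implicit Types u v w : E.

Definition opair (p q : 'rV[F]_4) : E := row_mx p q.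

(** Cayley-Dickson doubling of the standard quaternions with parameter -1. *)
Definition emul v w : E :=
  row_mx (qmul (lsubmx v) (lsubmx w) - qmul (qbar (rsubmx w)) (rsubmx v))
         (qmul (rsubmx w) (lsubmx v) + qmul (rsubmx v) (qbar (lsubmx w))).

(** The symmetric form whose quadratic form is the norm. *)
Definition edot v w : F :=
  qdot (lsubmx v) (lsubmx w) + qdot (rsubmx v) (rsubmx w).

Definition e1 : E := opair (q4 1 0 0 0) (q4 0 0 0 0).
Definition ei : E := opair (q4 0 1 0 0) (q4 0 0 0 0).
Definition ej : E := opair (q4 0 0 1 0) (q4 0 0 0 0).
Definition ebar v : E := (edot v e1 *+ 2) *: e1 - v.

Variant oct_spec : E -> Type :=
  OctSpec a0 a1 a2 a3 b0 b1 b2 b3 :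
    oct_spec (opair (q4 a0 a1 a2 a3) (q4 b0 b1 b2 b3)).

Lemma octP v : oct_spec v.
Proof.
rewrite -[v]hsubmxK -/(opair _ _); move: (lsubmx v) (rsubmx v) => p q.
by case: (q4P p) => ????; case: (q4P q).
Qed.

Lemma opairK v : opair (lsubmx v) (rsubmx v) = v.
Proof. exact: hsubmxK. Qed.

Lemma emul_oct p q r s : emul (opair p q) (opair r s) =
  opair (qmul p r - qmul (qbar s) q) (qmul s p + qmul q (qbar r)).
Proof. by rewrite /emul !row_mxKl !row_mxKr. Qed.

Lemma edot_oct p q r s : edot (opair p q) (opair r s) = qdot p r + qdot q s.
Proof. by rewrite /edot !row_mxKl !row_mxKr. Qed.

Lemma octD p q r s : opair p q + opair r s = opair (p + r) (q + s).
Proof. exact: add_row_mx. Qed.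

Lemma octN p q : - opair p q = opair (- p) (- q).
Proof. exact: opp_row_mx. Qed.

Lemma octZ c p q : c *: opair p q = opair (c *: p) (c *: q).
Proof. exact: scale_row_mx. Qed.

Lemma ebar_oct p q : ebar (opair p q) = opair (qbar p) (- q).
Proof.
rewrite /ebar /e1 edot_oct octZ octN octD.
case: (q4P p) (q4P q) => ???? [] ????; rewrite !q4E.
by congr opair; congr q4; ring.
Qed.

Definition octE := (emul_oct, edot_oct, ebar_oct, octD, octN, octZ).

End StandardOctonions.

Ltac oct_ring :=
  rewrite ?/e1 ?/ei ?/ej ?octE ?q4E;
  first [congr opair; congr q4 | idtac]; ring.

Section OctonionIdentities.
Variable F : fieldType.
Implicit Types u v w : 'rV[F]_(4 + 4).
Local Notation e1 := (e1 F).

Lemma emulDl u v w : emul (u + v) w = emul u w + emul v w.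
Proof.
by case: (octP u) (octP v) (octP w) => ???????? [] ???????? [] ????????;
  oct_ring.
Qed.

Lemma emulDr u v w : emul u (v + w) = emul u v + emul u w.
Proof.
by case: (octP u) (octP v) (octP w) => ???????? [] ???????? [] ????????;
  oct_ring.
Qed.

Lemma emulZl c u v : emul (c *: u) v = c *: emul u v.
Proof. by case: (octP u) (octP v) => ???????? [] ????????; oct_ring. Qed.

Lemma emulZr c u v : emul u (c *: v) = c *: emul u v.
Proof. by case: (octP u) (octP v) => ???????? [] ????????; oct_ring. Qed.

Lemma emul1l v : emul e1 v = v.
Proof. by case: (octP v) => ????????; oct_ring. Qed.

Lemma emul1r v : emul v e1 = v.
Proof. by case: (octP v) => ????????; oct_ring. Qed.

Lemma ebarM u v : ebar (emul u v) = emul (ebar v) (ebar u).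
Proof. by case: (octP u) (octP v) => ???????? [] ????????; oct_ring. Qed.

(** Polarised left alternativity; with [mulK_ebar], [edot_mull] and
    [edot_mulr] it replaces associativity in the octonions. *)
Lemma ebar_mulK u v w :
  emul (ebar u) (emul v w) + emul (ebar v) (emul u w) = (edot u v *+ 2) *: w.
Proof.
by case: (octP u) (octP v) (octP w) => ???????? [] ???????? [] ????????;
  oct_ring.
Qed.

Lemma mulK_ebar u v w :
  emul (emul w u) (ebar v) + emul (emul w v) (ebar u) = (edot u v *+ 2) *: w.
Proof.
by case: (octP u) (octP v) (octP w) => ???????? [] ???????? [] ????????;
  oct_ring.
Qed.

Lemma edot_mull u v w : edot (emul u v) w = edot v (emul (ebar u) w).
Proof.
by case: (octP u) (octP v) (octP w) => ???????? [] ???????? [] ????????;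
  oct_ring.
Qed.

Lemma edot_mulr u v w : edot (emul u v) w = edot u (emul w (ebar v)).
Proof.
by case: (octP u) (octP v) (octP w) => ???????? [] ???????? [] ????????;
  oct_ring.
Qed.

End OctonionIdentities.

(** * Bilinear products and quaternion subalgebras *)

Section BilinearMaps.
Variable F : fieldType.

Definition bilin (A B C : lmodType F) (f : A -> B -> C) : Prop :=
  (forall c u v w, f (c *: u + v) w = c *: f u w + f v w) /\
  (forall c u v w, f u (c *: v + w) = c *: f u v + f u w).

Variables (A B C : lmodType F) (f : A -> B -> C).
Hypothesis bilin_f : bilin f.

Lemma bilinDl u v w : f (u + v) w = f u w + f v w.
Proof. by rewrite -[u]scale1r bilin_f.1 !scale1r. Qed.

Lemma bilinDr u v w : f u (v + w) = f u v + f u w.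
Proof. by rewrite -[v]scale1r bilin_f.2 !scale1r. Qed.

Lemma bilin0l w : f 0 w = 0.
Proof. by apply: (addrI (f 0 w)); rewrite -bilinDl !addr0. Qed.

Lemma bilin0r u : f u 0 = 0.
Proof. by apply: (addrI (f u 0)); rewrite -bilinDr !addr0. Qed.

Lemma bilinZl c u w : f (c *: u) w = c *: f u w.
Proof. by rewrite -[c *: u]addr0 bilin_f.1 bilin0l addr0. Qed.

Lemma bilinZr c u w : f u (c *: w) = c *: f u w.
Proof. by rewrite -[c *: w]addr0 bilin_f.2 bilin0r addr0. Qed.

End BilinearMaps.

Section QuaternionEmbedding.
Variables (F : fieldType) (A : lmodType F) (mul : A -> A -> A).
Hypothesis bilin_mul : bilin mul.

(** The candidate embedding of the standard quaternions sending the units to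
    one, i, j, k. It is used both in the associative algebra Q and in the
    octonions, hence the absence of any associativity in [quatM]. *)
Definition quat (one i j k : A) (a : 'rV[F]_4) : A :=
  qco a 0 *: one + qco a 1 *: i + qco a 2 *: j + qco a 3 *: k.

Variables one i j k : A.
Local Notation h := (quat one i j k).

Lemma quatP c a b : h (c *: a + b) = c *: h a + h b.
Proof.
rewrite /quat; case: (q4P a) (q4P b) => ???? [] ????; rewrite !q4E !qco_q4.
by rewrite !scalerDl !scalerDr !scalerA (AC (2*2*2*2) ((1*3*5*7)*(2*4*6*8))%AC).
Qed.

Lemma quatD a b : h (a + b) = h a + h b.
Proof. by have := quatP 1 a b; rewrite !scale1r. Qed.

Lemma quat0 : h 0 = 0.
Proof. by apply: (addrI (h 0)); rewrite -quatD !addr0. Qed.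

Lemma quatZ c a : h (c *: a) = c *: h a.
Proof. by rewrite -[c *: a]addr0 quatP quat0 addr0. Qed.

Lemma quatN a : h (- a) = - h a.
Proof. by rewrite -[- a]scaleN1r quatZ scaleN1r. Qed.

Hypotheses (mul11 : mul one one = one) (mul1i : mul one i = i)
  (mul1j : mul one j = j) (mul1k : mul one k = k) (muli1 : mul i one = i)
  (mulj1 : mul j one = j) (mulk1 : mul k one = k).
Hypotheses (mulii : mul i i = - one) (muljj : mul j j = - one)
  (mulkk : mul k k = - one) (mulij : mul i j = k) (mulji : mul j i = - k)
  (muljk : mul j k = i) (mulkj : mul k j = - i) (mulki : mul k i = j)
  (mulik : mul i k = - j).

Lemma quatM a b : mul (h a) (h b) = h (qmul a b).
Proof.
have mulDl := bilinDl bilin_mul; have mulDr := bilinDr bilin_mul.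
have mulZl := bilinZl bilin_mul; have mulZr := bilinZr bilin_mul.
case: (q4P a) (q4P b) => a0 a1 a2 a3 [] b0 b1 b2 b3.
rewrite !q4E /quat !qco_q4 !mulDl !mulDr !mulZl !mulZr.
rewrite mul11 mul1i mul1j mul1k muli1 mulj1 mulk1 mulii muljj mulkk mulij
  mulji muljk mulkj mulki mulik.
rewrite !scalerA !scalerN -!scaleNr.
rewrite !scalerDl.
by rewrite [LHS](AC (4*4*4*4)
  ((1*6*11*16)*(2*5*12*15)*(3*8*9*14)*(4*7*10*13))%AC).
Qed.

End QuaternionEmbedding.

(** * The norm form of the standard octonions *)

Section Frames.
Variable F : fieldType.
Local Notation E := 'rV[F]_(4 + 4).
Implicit Types u v w : E.

Lemma emul_bilin : bilin (@emul F).
Proof.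
by split=> c u v w; rewrite ?emulDl ?emulDr ?emulZl ?emulZr.
Qed.

Lemma edotC u v : edot u v = edot v u.
Proof. by case: (octP u) (octP v) => ???????? [] ????????; oct_ring. Qed.

Lemma edotDl u v w : edot (u + v) w = edot u w + edot v w.
Proof.
by case: (octP u) (octP v) (octP w) => ???????? [] ???????? [] ????????;
  oct_ring.
Qed.

Lemma edotZl c u v : edot (c *: u) v = c * edot u v.
Proof. by case: (octP u) (octP v) => ???????? [] ????????; oct_ring. Qed.

Lemma edotNl u v : edot (- u) v = - edot u v.
Proof. by rewrite -[- u]scaleN1r edotZl mulN1r. Qed.

Lemma edot0l v : edot 0 v = 0.
Proof. by rewrite -(scale0r v) edotZl mul0r. Qed.

Lemma edotBl u v w : edot (u - v) w = edot u w - edot v w.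
Proof. by rewrite edotDl edotNl. Qed.

Lemma edotDr u v w : edot u (v + w) = edot u v + edot u w.
Proof. by rewrite edotC edotDl !(edotC u). Qed.

Lemma edotBr u v w : edot u (v - w) = edot u v - edot u w.
Proof. by rewrite edotC edotBl !(edotC u). Qed.

Lemma edotZr c u v : edot u (c *: v) = c * edot u v.
Proof. by rewrite edotC edotZl edotC. Qed.

Lemma edotNr u v : edot u (- v) = - edot u v.
Proof. by rewrite edotC edotNl edotC. Qed.

Lemma edot_sum u v : edot u v = \sum_k u 0 k * v 0 k.
Proof.
case: (octP u) (octP v) => a0 a1 a2 a3 b0 b1 b2 b3 [] c0 c1 c2 c3 d0 d1 d2 d3.
rewrite big_split_ord /= !big_ord_recr !big_ord0 /= /opair.
by rewrite !(row_mxEl, row_mxEr) !mxE /= edot_oct !qdot_q4; ring.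
Qed.

Lemma edot_delta u k : edot u (delta_mx 0 k) = u 0 k.
Proof.
rewrite edot_sum (bigD1 k) //= big1 => [|j ne_jk]; rewrite !mxE ?eqxx ?mulr1 ?addr0 //.
by rewrite (negPf ne_jk) mulr0.
Qed.

Lemma edot11 : edot (e1 F) (e1 F) = 1.
Proof. by oct_ring. Qed.

Lemma ebar_pure u : edot u (e1 F) = 0 -> ebar u = - u.
Proof. by move=> u_pure; rewrite /ebar u_pure mul0rn scale0r add0r. Qed.

Lemma ebar_mulKv u v : emul (ebar u) (emul u v) = edot u u *: v.
Proof. by case: (octP u) (octP v) => ???????? [] ????????; oct_ring. Qed.

Lemma mulK_ebarv u v : emul (emul v u) (ebar u) = edot u u *: v.
Proof. by case: (octP u) (octP v) => ???????? [] ????????; oct_ring. Qed.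

Lemma emulNl u v : emul (- u) v = - emul u v.
Proof. by rewrite -[- u]scaleN1r emulZl scaleN1r. Qed.

Lemma emulNr u v : emul u (- v) = - emul u v.
Proof. by rewrite -[- v]scaleN1r emulZr scaleN1r. Qed.

Lemma edot_mul2l u v w : edot (emul u v) (emul u w) = edot u u * edot v w.
Proof. by rewrite edot_mull ebar_mulKv edotZr. Qed.

Lemma edot_mul2r u v w : edot (emul v u) (emul w u) = edot u u * edot v w.
Proof. by rewrite edot_mulr mulK_ebarv edotZr. Qed.

Lemma ebarK : involutive (@ebar F).
Proof. by move=> u; case: (octP u) => ????????; oct_ring. Qed.

Lemma qbarK : involutive (@qbar F).
Proof. by move=> a; case: (q4P a) => ????; rewrite !q4E !opprK. Qed.

Lemma qbarM (a b : 'rV[F]_4) : qbar (qmul a b) = qmul (qbar b) (qbar a).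
Proof.
by case: (q4P a) (q4P b) => ???? [] ????; rewrite !q4E; congr q4; ring.
Qed.

End Frames.

(** * Automorphisms of the standard octonions *)

Section Automorphisms.
Variable F : fieldType.
Local Notation E := 'rV[F]_(4 + 4).
Implicit Types (u v w : E) (A B : 'M[F]_(4 + 4)).

(** An automorphism as an orthogonal matrix acting on rows: the transpose is
    then the inverse, with no need to construct one. *)
Definition aut A : Prop :=
  [/\ forall u v, emul u v *m A = emul (u *m A) (v *m A),
      e1 F *m A = e1 F & A *m A^T = 1%:M].

Lemma aut_mul A B : aut A -> aut B -> aut (A *m B).
Proof.
case=> mA A1 AAt [mB B1 BBt]; split=> [u v||].
- by rewrite !mulmxA mA mB.
- by rewrite mulmxA A1 B1.
- by rewrite trmx_mul mulmxA -(mulmxA A) BBt mulmx1.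
Qed.

Lemma aut_tr A : aut A -> aut A^T.
Proof.
case=> mA A1 AAt; have AtA := mulmx1C AAt; split=> [u v||].
- by rewrite -{1}[u]mulmx1 -{1}[v]mulmx1 -AtA !mulmxA -mA -mulmxA AAt mulmx1.
- by rewrite -[in LHS]A1 -mulmxA AAt mulmx1.
- by rewrite trmxK.
Qed.

Section Frame.
Variables u w : E.
Hypotheses (u_pure : edot u (e1 F) = 0) (w_pure : edot w (e1 F) = 0).
Hypotheses (uu : edot u u = 1) (ww : edot w w = 1) (uw : edot u w = 0).
Local Notation v := (emul u w).
Local Notation h := (quat (e1 F) u w v).

Let bu : ebar u = - u. Proof. exact: ebar_pure. Qed.
Let bw : ebar w = - w. Proof. exact: ebar_pure. Qed.

Let ulK x : emul u (emul u x) = - x.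
Proof. by rewrite -[emul _ _]opprK -emulNl -bu ebar_mulKv uu scale1r. Qed.
Let urK x : emul (emul x u) u = - x.
Proof. by rewrite -[emul _ _]opprK -emulNr -bu mulK_ebarv uu scale1r. Qed.
Let wlK x : emul w (emul w x) = - x.
Proof. by rewrite -[emul _ _]opprK -emulNl -bw ebar_mulKv ww scale1r. Qed.
Let wrK x : emul (emul x w) w = - x.
Proof. by rewrite -[emul _ _]opprK -emulNr -bw mulK_ebarv ww scale1r. Qed.

Let wu : emul w u = - emul u w.
Proof.
have := ebar_mulK u w (e1 F).
rewrite uw mul0rn scale0r !emul1r bu bw !emulNl => /eqP.
by rewrite -opprD oppr_eq0 addrC addr_eq0 => /eqP.
Qed.

Let v_pure : edot v (e1 F) = 0.
Proof. by rewrite edot_mull bu emul1r edotNr edotC uw oppr0. Qed.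

Let vv : edot v v = 1.
Proof. by rewrite edot_mull ebar_mulKv uu scale1r ww. Qed.

Let uv : edot u v = 0.
Proof. by rewrite -[u in edot u _]emul1r edot_mul2l edotC w_pure mulr0. Qed.

Let wv : edot w v = 0.
Proof. by rewrite -[w in edot w _]emul1l edot_mul2r edotC u_pure mulr0. Qed.

Let bv : ebar v = - v. Proof. exact: ebar_pure. Qed.

Let hM a b : emul (h a) (h b) = h (qmul a b).
Proof.
apply: quatM; rewrite ?emul1l ?emul1r //; first exact: emul_bilin.
- by rewrite -{2}[u]emul1r ulK.
- by rewrite -{2}[w]emul1r wlK.
- rewrite -[X in emul X]opprK -bv emulNl -[X in emul _ X]emul1r ebar_mulKv.
  by rewrite vv scale1r.
- by rewrite -[emul u w]opprK -wu emulNr wlK opprK.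
- by rewrite -[emul u w]opprK -wu emulNl urK opprK.
Qed.

Let hbar a : ebar (h a) = h (qbar a).
Proof.
case: (q4P a) => a0 a1 a2 a3; rewrite !q4E /ebar /quat !qco_q4.
rewrite !edotDl !edotZl edot11 u_pure w_pure v_pure !mulr0 !addr0 mulr1.
by rewrite !scaleNr mulr2n scalerDl !opprD !addrA addrK.
Qed.

Let h_dot a b : edot (h a) (h b) = qdot a b.
Proof.
case: (q4P a) (q4P b) => a0 a1 a2 a3 [] b0 b1 b2 b3; rewrite !q4E /quat !qco_q4.
rewrite !(edotDl, edotDr, edotZl, edotZr) edot11 u_pure w_pure v_pure.
rewrite !(edotC (e1 F)) u_pure w_pure v_pure uu ww vv uw uv wv.
by rewrite (edotC w) uw !(edotC v) uv wv; ring.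
Qed.

(** If every vector normal to the quaternion subalgebra were isotropic, the
    projections of the eight basis vectors to the normal space would all have
    norm 0; but the sum of these norms is 8 - 4. *)
Lemma unit_normal_exists : (2 : F) != 0 ->
  (forall x : E, exists c, edot x x = c ^+ 2) ->
  exists z, edot z z = 1 /\ forall a, edot (h a) z = 0.
Proof.
move=> two_neq0 sq.
pose c k := q4 (e1 F 0 k) (u 0 k) (w 0 k) (v 0 k).
pose y k := delta_mx 0 k - h (c k).
have h_delta a k : edot (h a) (delta_mx 0 k) = qdot a (c k).
  case: (q4P a) => ????; rewrite /c q4E /quat !qco_q4.
  by rewrite !edotDl !edotZl !edot_delta.
have hy a k : edot (h a) (y k) = 0.
  by rewrite edotBr h_delta h_dot subrr.
have yy k : edot (y k) (y k) = 1 - qdot (c k) (c k).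
  rewrite {1}/y edotBl hy subr0 edotC edotBl edot_delta mxE !eqxx.
  by rewrite h_delta.
have [k yk_neq0] : exists k, edot (y k) (y k) != 0.
  apply/existsP; apply: contraT; rewrite negb_exists => /forallP y0.
  have: \sum_k edot (y k) (y k) = 2 * 2.
    transitivity (\sum_k (1 - (e1 F 0 k * e1 F 0 k + u 0 k * u 0 k +
      w 0 k * w 0 k + v 0 k * v 0 k))).
      by apply: eq_bigr => k _; rewrite yy qdot_q4.
    rewrite big_split /= sumr_const card_ord sumrN !big_split /=.
    by rewrite -!edot_sum edot11 uu ww vv; ring.
  rewrite big1 => [/esym/eqP|k _]; first by rewrite mulf_eq0 orbb (negPf two_neq0).
  by apply/eqP; move: (y0 k); rewrite negbK.
have [d yk_d] := sq (y k).
have d_neq0 : d != 0 by move: yk_neq0; rewrite yk_d expf_eq0.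
exists (d^-1 *: y k); split; last by move=> a; rewrite edotZr hy mulr0.
by rewrite edotZl edotZr yk_d; field.
Qed.

Variable z : E.
Hypotheses (zz : edot z z = 1) (hz : forall a, edot (h a) z = 0).

Let z_pure : edot z (e1 F) = 0.
Proof.
have := hz (q4 1 0 0 0); rewrite /quat !qco_q4 !scale0r !addr0 scale1r.
by rewrite edotC.
Qed.

Let bz : ebar z = - z. Proof. exact: ebar_pure. Qed.

(** The products of the quaternion subalgebra H = h(F^4) and H z are those of
    the Cayley-Dickson doubling of H, because z is normal to H. *)
Let zh a : emul z (h a) = emul (h (qbar a)) z.
Proof.
have X_pure : edot (emul z (h a)) (e1 F) = 0.
  by rewrite edot_mulr emul1l hbar edotC hz.
by apply: oppr_inj; rewrite -ebar_pure // ebarM bz emulNr hbar.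
Qed.

Let hhz a b : emul (h a) (emul (h b) z) = emul (h (qmul b a)) z.
Proof.
have := ebar_mulK (h (qbar a)) z (h (qbar b)).
rewrite hz mul0rn scale0r hbar qbarK zh qbarK bz emulNl hM zh => /eqP.
by rewrite subr_eq0 qbarM !qbarK => /eqP.
Qed.

Let hz_pure a : ebar (emul (h a) z) = - emul (h a) z.
Proof. by apply: ebar_pure; rewrite edot_mull emul1r hbar edotC hz. Qed.

Let hzh a b : emul (emul (h a) z) (h b) = emul (h (qmul a (qbar b))) z.
Proof.
apply: (can_inj (@ebarK F)).
by rewrite ebarM !hz_pure hbar emulNr hhz.
Qed.

Let hzhz a b : emul (emul (h a) z) (emul (h b) z) = - h (qmul (qbar b) a).
Proof.
set X := emul (h a) z; have Xbar : ebar (- X) = X by rewrite -hz_pure ebarK.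
have X_z : edot X z = qco a 0.
  rewrite -[z in edot X z]emul1l edot_mul2r zz mul1r.
  have <- : edot (h a) (h (q4 1 0 0 0)) = edot (h a) (e1 F).
    by congr edot; rewrite /quat !qco_q4 !scale0r !addr0 scale1r.
  by rewrite h_dot; case: (q4P a) => ????; rewrite !q4E qco_q4; ring.
have := ebar_mulK (- X) z (h (qbar b)).
rewrite Xbar [emul z (h _)]zh qbarK bz !emulNl emulNr opprK hzh qbarK.
have -> : emul z (emul (h (qmul a b)) z) = - h (qbar (qmul a b)).
  rewrite -[qmul a b in LHS]qbarK -zh.
  by rewrite -[emul _ _]opprK -emulNl -bz ebar_mulKv zz scale1r.
rewrite edotNl X_z => /eqP; rewrite subr_eq => /eqP ->.
rewrite -quatZ -quatD -quatN; congr h.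
case: (q4P a) (q4P b) => ???? [] ????; rewrite !(q4E, qco_q4).
by congr q4; ring.
Qed.

(** The map from the double F^4 + F^4 to H + H z. *)
Let Phi (x : E) : E := h (lsubmx x) + emul (h (rsubmx x)) z.

Let PhiE p q : Phi (opair p q) = h p + emul (h q) z.
Proof. by rewrite /Phi row_mxKl row_mxKr. Qed.

Let PhiP c x y : Phi (c *: x + y) = c *: Phi x + Phi y.
Proof.
rewrite -(opairK x) -(opairK y) octZ octD !PhiE.
by rewrite !quatP emulDl emulZl [c *: (_ + emul _ _)]scalerDr addrACA.
Qed.

Let PhiM x y : Phi (emul x y) = emul (Phi x) (Phi y).
Proof.
rewrite -(opairK x) -(opairK y) emul_oct !PhiE.
rewrite !(emulDl _ (emul _ z)) !(emulDr _ _ (emul _ z)).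
rewrite hM hhz hzh hzhz !quatD quatN (emulDl (h _)).
by rewrite [RHS](AC (2*2) ((1*4)*(2*3))%AC).
Qed.

Let Phi_dot x y : edot (Phi x) (Phi y) = edot x y.
Proof.
rewrite -(opairK x) -(opairK y) edot_oct !PhiE.
rewrite !(edotDl _ (emul _ z)) !(edotDr _ _ (emul _ z)).
rewrite h_dot edot_mul2r h_dot zz mul1r.
have cross a b : edot (emul (h a) z) (h b) = 0.
  by rewrite edot_mull hbar hM edotC hz.
by rewrite (edotC (h _)) !cross !addr0 add0r.
Qed.

Lemma frame_aut_of_normal : exists A, [/\ aut A,
  ei F *m A = u & ej F *m A = w].
Proof.
pose A : 'M[F]_(4 + 4) := \matrix_i Phi (delta_mx 0 i).
have Phi0 : Phi 0 = 0 by have := PhiP (-1) 0 0; rewrite scaler0 addr0 scaleN1r addNr.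
have PhiA x : x *m A = Phi x.
  rewrite [x in RHS]row_sum_delta mulmx_sum_row.
  elim/big_rec2: _ => [|i y1 y2 _ ->]; first by [].
  by rewrite PhiP rowK.
exists A; split.
- split=> [x y||]; first by rewrite !PhiA PhiM.
  + rewrite PhiA /e1 PhiE /quat !qco_q4 !scale0r scale1r !addr0.
    by rewrite (bilin0l (@emul_bilin F)) addr0.
  + apply/matrixP=> i j; rewrite mxE.
    transitivity (edot (Phi (delta_mx 0 i)) (Phi (delta_mx 0 j))).
      by rewrite edot_sum; apply: eq_bigr => k _; rewrite !mxE.
    by rewrite Phi_dot edot_delta !mxE eqxx /= eq_sym.
- rewrite PhiA /ei PhiE /quat !qco_q4 !scale0r scale1r add0r !addr0.
  by rewrite (bilin0l (@emul_bilin F)) addr0.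
- rewrite PhiA /ej PhiE /quat !qco_q4 !scale0r scale1r !add0r !addr0.
  by rewrite (bilin0l (@emul_bilin F)) addr0.
Qed.

End Frame.

Lemma frame_aut u w : (2 : F) != 0 ->
    (forall x : E, exists c, edot x x = c ^+ 2) ->
    edot u (e1 F) = 0 -> edot w (e1 F) = 0 ->
    edot u u = 1 -> edot w w = 1 -> edot u w = 0 ->
  exists A, [/\ aut A,
    ei F *m A = u & ej F *m A = w].
Proof.
move=> two_neq0 sq u1 w1 uu ww uw.
have [z [zz hz]] := unit_normal_exists u1 w1 uu ww uw two_neq0 sq.
exact: (@frame_aut_of_normal u w _ _ _ _ _ z).
Qed.
End Automorphisms.

(** * Conjugacy of pure octonions *)

Section Conjugacy.
Variable F : fieldType.
Hypothesis two_neq0 : (2 : F) != 0.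
Local Notation E := 'rV[F]_(4 + 4).
Hypothesis norm_square : forall x : E, exists c, edot x x = c ^+ 2.
Implicit Types u v w x : E.

(** Among the imaginary quaternions: if the first imaginary coordinate a_1 of
    u is 0 the first unit will do. Otherwise one of (a_2, - a_1, 0),
    (a_3, 0, - a_1), (0, a_3, - a_2) is anisotropic, for
    a_1^2 + a_2^2 = a_1^2 + a_3^2 = a_2^2 + a_3^2 = 0 gives 2 a_1^2 = 0. *)
Lemma unit_orth_exists u :
  exists w, [/\ edot w (e1 F) = 0, edot w w = 1 & edot u w = 0].
Proof.
suff [w [w_pure uw ww]] : exists w,
    [/\ edot w (e1 F) = 0, edot u w = 0 & edot w w != 0].
  have [c wwc] := norm_square w; have c_neq0 : c != 0.
    by move: ww; rewrite wwc expf_eq0.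
  exists (c^-1 *: w); rewrite !(edotZl, edotZr) w_pure uw wwc !mulr0.
  by split=> //; field.
case: (octP u) => a0 a1 a2 a3 b0 b1 b2 b3.
pose w y1 y2 y3 : E := opair (q4 0 y1 y2 y3) (q4 0 0 0 0).
have wP y1 y2 y3 : y1 ^+ 2 + y2 ^+ 2 + y3 ^+ 2 != 0 ->
    a1 * y1 + a2 * y2 + a3 * y3 = 0 -> exists w : E,
    [/\ edot w (e1 F) = 0,
        edot (opair (q4 a0 a1 a2 a3) (q4 b0 b1 b2 b3)) w = 0 & edot w w != 0].
  move=> x_neq0 ax; exists (w y1 y2 y3); rewrite /w /e1 !octE !q4E; split.
  - by ring.
  - by rewrite -[RHS]ax; ring.
  - by apply: contra_neq x_neq0 => <-; ring.
have [a1_0|a1_neq0] := eqVneq a1 0.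
  by apply: (wP 1 0 0); rewrite ?a1_0 ?expr0n ?addr0 ?expr1n ?oner_eq0 //; ring.
have [s12|] := eqVneq (a1 ^+ 2 + a2 ^+ 2) 0; last first.
  by move=> s12; apply: (wP a2 (- a1) 0); [apply: contra_neq s12 => <-|]; ring.
have [s13|] := eqVneq (a1 ^+ 2 + a3 ^+ 2) 0; last first.
  by move=> s13; apply: (wP a3 0 (- a1)); [apply: contra_neq s13 => <-|]; ring.
apply: (wP 0 a3 (- a2)); last by ring.
have -> : 0 ^+ 2 + a3 ^+ 2 + (- a2) ^+ 2 = - (2 * a1 ^+ 2) +
  (a1 ^+ 2 + a2 ^+ 2) + (a1 ^+ 2 + a3 ^+ 2) by ring.
by rewrite s12 s13 !addr0 oppr_eq0 mulf_neq0 // expf_neq0.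
Qed.

Lemma anisotropic_conj_ei c u : c != 0 -> edot u (e1 F) = 0 ->
  edot u u = c ^+ 2 -> exists2 A, aut A & (c *: ei F) *m A = u.
Proof.
move=> c_neq0 u_pure uu.
have u'1 : edot (c^-1 *: u) (e1 F) = 0 by rewrite edotZl u_pure mulr0.
have u'u' : edot (c^-1 *: u) (c^-1 *: u) = 1.
  by rewrite edotZl edotZr uu; field.
have [w [w1 ww uw]] := unit_orth_exists (c^-1 *: u).
have [A [autA eiA _]] := frame_aut two_neq0 norm_square u'1 w1 u'u' ww uw.
by exists A => //; rewrite -scalemxAl eiA scalerA divff // scale1r.
Qed.

(** If v_k is not 0, the other coordinates have a norm c^2 with
    v_k^2 + c^2 = 0. *)
Lemma isotropic_sqrtN1 v : v != 0 -> edot v v = 0 -> exists i : F, i ^+ 2 = -1.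
Proof.
case/rV0Pn=> k vk vv.
have [c xx] := norm_square (v - v 0 k *: delta_mx 0 k).
exists (c / v 0 k); rewrite expr_div_n -xx !(edotBl, edotBr, edotZl, edotZr).
rewrite (edotC (delta_mx 0 k) v) !edot_delta mxE !eqxx vv /=.
by field.
Qed.

(** An isotropic pure u is y + i w for an orthonormal pair (y, w), which a frame
    carries back to the first two imaginary units. *)
Lemma nilpotent_conj i u : i ^+ 2 = -1 -> u != 0 -> edot u (e1 F) = 0 ->
  edot u u = 0 -> exists2 A, aut A & (ei F + i *: ej F) *m A = u.
Proof.
move=> ii /rV0Pn[k uk] u1 uu; set a := u 0 k in uk.
(* y is a pure unit vector with (u, y) = 1: the pure part of delta_mx 0 k
   scaled to have the right product with u, corrected by the multiple of u
   that makes its norm 1. Then w = - i (u - y) is a unit vector too. *)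
pose y := a^-1 *: (delta_mx 0 k - e1 F 0 k *: e1 F) +
  ((1 - (1 - e1 F 0 k ^+ 2) / a ^+ 2) / 2) *: u.
have y1 : edot y (e1 F) = 0.
  rewrite /y !(edotDl, edotNl, edotZl) edot11 u1 (edotC _ (e1 F)) edot_delta.
  by ring.
have uy : edot u y = 1.
  rewrite /y !(edotDr, edotNr, edotZr) uu u1 edot_delta -/a.
  by field; rewrite two_neq0.
have yy : edot y y = 1.
  rewrite {1}/y !(edotDl, edotNl, edotZl) uy (edotC (e1 F)) y1.
  rewrite (edotC _ y) /y !(edotDl, edotNl, edotZl) !edot_delta -/a.
  rewrite [delta_mx _ _ _ _]mxE !eqxx /=.
  by field; rewrite two_neq0.
pose w := (- i) *: (u - y).
have wy : edot y w = 0 by rewrite edotZr edotBr (edotC y) uy yy subrr mulr0.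
have w1 : edot w (e1 F) = 0 by rewrite edotZl edotBl u1 y1 subrr mulr0.
have ww : edot w w = 1.
  rewrite edotZl edotZr !(edotBl, edotBr) (edotC y u) uu uy yy.
  by rewrite mulrA mulrNN -expr2 ii; ring.
have [A [autA eiA ejA]] := frame_aut two_neq0 norm_square y1 w1 yy ww wy.
exists A => //; rewrite mulmxDl -scalemxAl eiA ejA scalerA mulrN -expr2 ii.
by rewrite opprK scale1r addrC subrK.
Qed.

(** The transitivity of the automorphism group on pure octonions of a given
    norm, through the normal forms c e_i and e_i + i e_j. *)
Lemma pure_conj u v : u != 0 -> v != 0 -> edot u (e1 F) = 0 ->
  edot v (e1 F) = 0 -> edot u u = edot v v -> exists2 A, aut A & u *m A = v.
Proof.
move=> u_neq0 v_neq0 u1 v1 uv.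
suff [x [A autA xA] [B autB xB]] : exists2 x,
    exists2 A, aut A & x *m A = u & exists2 A, aut A & x *m A = v.
  exists (A^T *m B); first by apply: aut_mul => //; apply: aut_tr.
  by case: autA => _ _ AAt; rewrite -xA !mulmxA -(mulmxA x) AAt mulmx1.
have [c vc] := norm_square v; have [c0|c_neq0] := eqVneq c 0.
  have vv : edot v v = 0 by rewrite vc c0 expr0n.
  have [i ii] := isotropic_sqrtN1 v_neq0 vv.
  by exists (ei F + i *: ej F); apply: nilpotent_conj; rewrite ?uv.
by exists (c *: ei F); apply: anisotropic_conj_ei; rewrite ?uv.
Qed.

End Conjugacy.

(** * Multilinear maps *)

Section Updates.
Variables (n : nat) (T : Type).
Implicit Types (a : 'I_n -> T) (x : T).

Definition upd a (i : 'I_n) x : 'I_n -> T := fun j => if j == i then x else a j.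

Lemma upd_id a i : upd a i (a i) =1 a.
Proof. by move=> j; rewrite /upd; case: eqP => // ->. Qed.

End Updates.

Section Spanning.
Variable F : fieldType.

Definition lin_closed (A : lmodType F) (W : A -> Prop) : Prop :=
  W 0 /\ (forall c u v, W u -> W v -> W (c *: u + v)).

(** Spanning, as an induction principle, which spares explicit coordinates. *)
Definition spanning (A : lmodType F) (J : Type) (b : J -> A) : Prop :=
  forall W, lin_closed W -> (forall j, W (b j)) -> forall x, W x.

End Spanning.

Section MultilinearMaps.
Variables (F : fieldType) (n : nat) (A B : lmodType F).

(** The first clause is extensionality in the tuple of arguments. *)
Definition mlin (M : ('I_n -> A) -> B) : Prop :=
  (forall a b, a =1 b -> M a = M b) /\
  (forall a i c x y,
     M (upd a i (c *: x + y)) = c *: M (upd a i x) + M (upd a i y)).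

Variable M : ('I_n -> A) -> B.
Hypothesis mlinM : mlin M.

Lemma mlinD a i x y : M (upd a i (x + y)) = M (upd a i x) + M (upd a i y).
Proof. by rewrite -[x]scale1r mlinM.2 !scale1r. Qed.

Lemma mlin0 a i : M (upd a i 0) = 0.
Proof. by apply: (addrI (M (upd a i 0))); rewrite -mlinD !addr0. Qed.

Lemma mlinZ a i c x : M (upd a i (c *: x)) = c *: M (upd a i x).
Proof. by rewrite -[c *: x]addr0 mlinM.2 mlin0 addr0. Qed.

Lemma mlin_upd_id a i : M (upd a i (a i)) = M a.
Proof. by apply: mlinM.1; apply: upd_id. Qed.

Lemma mlin_span (J : finType) (b : J -> A) (W : B -> Prop) :
    spanning b -> lin_closed W ->
    (forall f : {ffun 'I_n -> J}, W (M (fun k => b (f k)))) ->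
  forall a, W (M a).
Proof.
move=> span [W0 Wlin] Wb.
suff W_le m a : (forall k : 'I_n, (m <= k)%N -> exists j, a k = b j) -> W (M a).
  by move=> a; apply: (W_le n) => k; rewrite leqNgt ltn_ord.
elim: m a => [|m IHm] a ba.
  have [f fP] := fin_all_exists (fun k => ba k isT).
  have := Wb (finfun f); rewrite (mlinM.1 _ a) // => k.
  by rewrite ffunE fP.
have [m_n|n_m] := ltnP m n; last first.
  apply: IHm => k mk; have := leq_ltn_trans (leq_trans n_m mk) (ltn_ord k).
  by rewrite ltnn.
rewrite -(mlin_upd_id a (Ordinal m_n)).
apply: (span (fun x => W (M (upd a (Ordinal m_n) x)))) => [|j].
  by split=> [|c x y]; [rewrite mlin0 | rewrite mlinM.2; apply: Wlin].
apply: IHm => k mk; rewrite /upd; case: eqP => [_|/eqP ne_k]; first by exists j.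
by apply: ba; rewrite ltn_neqAle mk andbT eq_sym; apply: contra ne_k.
Qed.

(** Two opposite vertices of a cube of tuples: if M vanishes at all the others,
    replace one entry e_j by e_j + e'_j at both ends. This changes neither of
    the two values, lowers the dimension, and preserves the vanishing. *)
Lemma subcube_pencil (e e' : 'I_n -> A) (D : {set 'I_n}) :
    let mix (S : {set 'I_n}) k := if k \in S then e' k else e k in
    D != set0 ->
    (forall S : {set 'I_n}, S \subset D -> S != set0 -> S != D -> M (mix S) = 0) ->
  exists a i x y, M (upd a i x) = M e /\ M (upd a i y) = M (mix D).
Proof.
elim: {D}#|D| {-2}D (erefl #|D|) e e' => [|d IHd] D cardD e e' mix.
  by rewrite -cards_eq0 cardD.
move=> D_neq0 M0; have [j Dj] := set0Pn _ D_neq0.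
have [D'0|D'_neq0] := eqVneq (D :\ j) set0.
  exists e, j, (e j), (e' j); split; first exact: mlin_upd_id.
  apply: mlinM.1 => k; rewrite /upd /mix -(setD1K Dj) D'0 setU0 inE.
  by case: eqP => [->|].
pose s := e j + e' j; pose f := upd e j s; pose f' := upd e' j s.
have Mmix (S : {set 'I_n}) : j \notin S ->
    M (fun k => if k \in S then f' k else f k) = M (mix S) + M (mix (j |: S)).
  move=> S'j; transitivity (M (upd (mix S) j s)).
    apply: mlinM.1 => k; rewrite /f /f' /upd /mix.
    by case: (k == j) => //; rewrite if_same.
  rewrite mlinD; congr (_ + _); apply: mlinM.1 => k; rewrite /upd /mix.
    by case: eqP => [->|//]; rewrite (negPf S'j).
  by rewrite !inE; case: eqP => [->|].
have mix0 : M (mix set0) = M e.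
  by apply: mlinM.1 => k; rewrite /mix inE.
have subD (S : {set 'I_n}) : S \subset D :\ j -> (S \subset D) && (S != D).
  by move=> sSD'; have := sub_proper_trans sSD' (properD1 Dj); rewrite properEneq andbC.
have subDj (S : {set 'I_n}) : S \subset D :\ j -> S != D :\ j ->
    [&& j |: S \subset D, j |: S != set0 & j |: S != D].
  move=> sSD' ne_S; have /andP[sSD _] := subD S sSD'.
  rewrite subUset sub1set Dj sSD /=; apply/andP; split.
    by apply/set0Pn; exists j; rewrite !inE eqxx.
  apply: contraNneq ne_S => <-; rewrite setU1K //.
  by apply: contraL sSD' => Sj; apply/subsetPn; exists j; rewrite ?inE ?eqxx.
have notinS (S : {set 'I_n}) : S \subset D :\ j -> j \notin S.
  by move=> sSD'; apply: contraL sSD' => Sj; apply/subsetPn; exists j; rewrite ?inE ?eqxx.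
have cardD' : #|D :\ j| = d by move: cardD; rewrite (cardsD1 j) Dj => -[].
have [|a [i [x [y [Mx My]]]]] := IHd _ cardD' f f' D'_neq0.
  move=> S sSD' S_neq0 ne_S; rewrite Mmix ?notinS //.
  have /andP[sSD ne_SD] := subD S sSD'.
  have /and3P[] := subDj S sSD' ne_S => *.
  by rewrite !M0 ?addr0.
exists a, i, x, y; rewrite Mx My; split.
  have -> : M f = M (fun k => if k \in set0 then f' k else f k).
    by apply: mlinM.1 => k; rewrite inE.
  have /and3P[] : [&& j |: set0 \subset D, j |: set0 != set0 & j |: set0 != D].
    by apply: subDj; rewrite ?sub0set // eq_sym.
  move=> *.
  by rewrite Mmix ?inE // mix0 (M0 (j |: set0)) ?addr0.
have /andP[sD'D ne_D'D] := subD _ (subxx (D :\ j)).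
by rewrite Mmix ?notinS // setD1K // (M0 (D :\ j)) ?add0r.
Qed.

(** For a closest pair f, g, each mixed tuple is nearer to both of them, so it
    satisfies neither P nor Q and [subcube_pencil] applies. *)
Lemma closest_pencil (J : eqType) (b : J -> A) (P Q : pred {ffun 'I_n -> J}) :
    (forall f, ~~ (P f && Q f)) ->
    (forall f : {ffun 'I_n -> J}, ~~ P f -> ~~ Q f -> M (fun k => b (f k)) = 0) ->
    forall f g, P f -> Q g ->
  exists f' g', [/\ P f', Q g' & exists a i x y,
    M (upd a i x) = M (fun k => b (f' k)) /\
    M (upd a i y) = M (fun k => b (g' k))].
Proof.
move=> PQ M0 f g.
pose D (f' g' : {ffun 'I_n -> J}) : {set 'I_n} := [set k | f' k != g' k].
move: {2}#|D f g|.+1 (ltnSn #|D f g|) => m.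
elim: m f g => // m IHm f g; rewrite ltnS => Dm Pf Qg.
pose mix (S : {set 'I_n}) : {ffun 'I_n -> J} := [ffun k => if k \in S then g k else f k].
have mixD : mix (D f g) = g.
  by apply/ffunP=> k; rewrite !ffunE inE; case: eqP.
have [/existsP[S /and4P[sSD S_neq0 S_neqD]]|] := boolP [exists S : {set 'I_n},
  [&& S \subset D f g, S != set0, S != D f g & P (mix S) || Q (mix S)]].
  have DmS : #|D f (mix S)| = #|S|.
    apply: eq_card => k; rewrite !inE ffunE.
    case: ifP => [Sk|]; last by rewrite eqxx.
    by have := subsetP sSD k Sk; rewrite inE.
  have DSg : D (mix S) g = D f g :\: S.
    apply/setP=> k; rewrite !inE ffunE.
    by case: ifP => [Sk|]; rewrite ?eqxx.
  have pSD : S \proper D f g by rewrite properEneq S_neqD.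
  case/orP=> [PS|QS].
    apply: (IHm (mix S) g) => //; apply: leq_trans Dm.
    rewrite DSg; apply: proper_card; rewrite properEneq subsetDl andbT.
    apply: contraNneq S_neq0 => DS; rewrite -subset0.
    by rewrite -(setIidPl sSD) -DS setIDA setDIl setDv set0I.
  apply: (IHm f (mix S)) => //; rewrite DmS; apply: leq_trans Dm.
  exact: proper_card.
rewrite negb_exists => /forallP noS; exists f, g; split=> //.
have D_neq0 : D f g != set0.
  apply: contraTneq Qg => D0; rewrite -mixD D0.
  have -> : mix set0 = f by apply/ffunP=> k; rewrite ffunE inE.
  by have := PQ f; rewrite Pf.
have [|a [i [x [y [Mx My]]]]] :=
  @subcube_pencil (fun k => b (f k)) (fun k => b (g k)) (D f g) D_neq0.
  move=> S sSD S_neq0 S_neqD; have := noS S; rewrite sSD S_neq0 S_neqD /= negb_or.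
  case/andP=> nP nQ; rewrite -[RHS](M0 _ nP nQ).
  by apply: mlinM.1 => k; rewrite ffunE; case: ifP.
exists a, i, x, y; rewrite Mx My; split=> //.
by apply: mlinM.1 => k; rewrite inE; case: eqP => //= ->.
Qed.

End MultilinearMaps.

(** * Multilinear polynomials over a nonassociative algebra *)

Section WordEvaluation.
Variables (F : fieldType) (n : nat) (A : lmodType F) (mul : A -> A -> A).
Implicit Types (a : 'I_n -> A) (w : word n) (p : napoly F n).

Fixpoint ev a w : A :=
  match w with
  | WVar i => a i
  | WMul u v => mul (ev a u) (ev a v)
  end.

Definition pev p a : A := \sum_(w <- msupp p) p@_w *: ev a w.

Lemma ev_ext a b w : a =1 b -> ev a w = ev b w.
Proof. by move=> ab; elim: w => [i|u IHu v IHv] /=; rewrite ?IHu ?IHv. Qed.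

Lemma ev_upd0 a i x w : occ i w = 0%N -> ev (upd a i x) w = ev a w.
Proof.
elim: w => [j|u IHu v IHv] /= => [|/eqP]; first by rewrite /upd eq_sym; case: eqP.
by rewrite addn_eq0 => /andP[/eqP u0 /eqP v0]; rewrite IHu ?IHv.
Qed.

Hypothesis bilin_mul : bilin mul.

Lemma ev_upd1 a i c x y w : occ i w = 1%N ->
  ev (upd a i (c *: x + y)) w = c *: ev (upd a i x) w + ev (upd a i y) w.
Proof.
elim: w => [j|u IHu v IHv] /=; first by rewrite /upd eq_sym; case: eqP.
case occu: (occ i u) IHu => [|[|m]] IHu; last by [].
  by move=> occv; rewrite !(ev_upd0 _ _ occu) IHv // bilin_mul.2.
rewrite add1n => -[occv]; rewrite !(ev_upd0 _ _ occv) IHu //.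
exact: bilin_mul.1.
Qed.

Lemma pev_mlin p : multilinear p -> mlin (pev p).
Proof.
move=> multi_p; split=> [a b ab|a i c x y].
  by apply: eq_bigr => w _; rewrite (ev_ext _ ab).
rewrite /pev scaler_sumr -big_split big_seq [RHS]big_seq /=.
apply: eq_bigr => w pw; rewrite ev_upd1 ?multi_p //.
by rewrite scalerDr !scalerA mulrC.
Qed.

(** Degrees add up in a commutative group whatever the bracketing, so all words
    with the same occurrences have the same degree. *)
Lemma ev_graded (I : zmodType) (Gr : I -> A -> Prop) a (d : 'I_n -> I) w :
    (forall g h x y, Gr g x -> Gr h y -> Gr (g + h) (mul x y)) ->
    (forall i, Gr (d i) (a i)) ->
  Gr (\sum_i d i *+ occ i w) (ev a w).
Proof.
move=> GrM Gra; elim: w => [i|u IHu v IHv] /=.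
  rewrite (bigD1 i) //= eqxx mulr1n big1 ?addr0 // => j /negPf->.
  by rewrite mulr0n.
by under eq_bigr do rewrite mulrnDr; rewrite big_split; apply: GrM.
Qed.

Lemma pev_graded (I : zmodType) (Gr : I -> A -> Prop) p a (d : 'I_n -> I) :
    multilinear p ->
    (forall g h x y, Gr g x -> Gr h y -> Gr (g + h) (mul x y)) ->
    (forall g, Gr g 0) ->
    (forall g c x y, Gr g x -> Gr g y -> Gr g (c *: x + y)) ->
    (forall i, Gr (d i) (a i)) ->
  Gr (\sum_i d i) (pev p a).
Proof.
move=> multi_p GrM Gr0 GrD Gra; set g := \sum_i d i; rewrite /pev big_seq.
elim/big_rec: _ => // w x pw Grx; apply: GrD => //.
have <- : \sum_i d i *+ occ i w = g by apply: eq_bigr => i _; rewrite multi_p.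
exact: ev_graded.
Qed.

End WordEvaluation.

Lemma pev_morph (F : fieldType) (n : nat) (A B : lmodType F)
    (mulA : A -> A -> A) (mulB : B -> B -> B) (phi : A -> B) (p : napoly F n) a :
    (forall c x y, phi (c *: x + y) = c *: phi x + phi y) ->
    (forall x y, phi (mulA x y) = mulB (phi x) (phi y)) ->
  phi (pev mulA p a) = pev mulB p (fun i => phi (a i)).
Proof.
move=> phiP phiM.
have phi0 : phi 0 = 0.
  by have := phiP (-1) 0 0; rewrite scaler0 addr0 scaleN1r addNr.
have phi_ev w : phi (ev mulA a w) = ev mulB (fun i => phi (a i)) w.
  by elim: w => //= u <- v <-.
rewrite /pev; elim/big_rec2: _ => // w x y _ <-.
by rewrite phiP phi_ev.
Qed.

(** * The grading of the octonions by the three-dimensional space over F_2 *)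

Section UnitGrading.
Variable F : fieldType.
Local Notation E := 'rV[F]_(4 + 4).
Local Notation Z23 := (bool * bool * bool)%type.
Implicit Types (g h : Z23) (u v : E).

(** F_2^2 indexes the units 1, i, j, k so that degrees add in products. *)
Definition qaxis (g : bool * bool) (c : F) : 'rV[F]_4 :=
  match g with
  | (false, false) => q4 c 0 0 0
  | (true, false) => q4 0 c 0 0
  | (false, true) => q4 0 0 c 0
  | (true, true) => q4 0 0 0 c
  end.

Definition axis g (c : F) : E :=
  if g.2 then opair 0 (qaxis g.1 c) else opair (qaxis g.1 c) 0.

Definition unit_vec g : E := axis g 1.

Lemma qaxisM (k l : bool * bool) c d :
  exists s, qmul (qaxis k c) (qaxis l d) = qaxis (k + l) s.
Proof.
have -> : k + l = (k.1 (+) l.1, k.2 (+) l.2) by [].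
pose p := qmul (qaxis k c) (qaxis l d).
exists (qco p 0 + qco p 1 + qco p 2 + qco p 3); rewrite {}/p.
by case: k l => [[] []] [[] []] /=; rewrite !q4E !qco_q4; congr q4; ring.
Qed.

Lemma qaxis_bar (k : bool * bool) c : exists s, qbar (qaxis k c) = qaxis k s.
Proof.
case: k => [[] []] /=; [exists (- c)|exists (- c)|exists (- c)|exists c];
  by rewrite !q4E ?oppr0.
Qed.

Lemma qaxisN (k : bool * bool) c : - qaxis k c = qaxis k (- c).
Proof. by case: k => [[] []] /=; rewrite !q4E ?oppr0. Qed.

Lemma qaxisZ (k : bool * bool) d c : d *: qaxis k c = qaxis k (d * c).
Proof. by case: k => [[] []] /=; rewrite !q4E ?mulr0. Qed.

Lemma axisZ g d c : d *: axis g c = axis g (d * c).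
Proof. by rewrite /axis; case: ifP => _; rewrite octZ qaxisZ scaler0. Qed.

Lemma axisM g h c d : exists s, emul (axis g c) (axis h d) = axis (g + h) s.
Proof.
have qmul0l p : qmul 0 p = 0 :> 'rV[F]_4.
  by rewrite q4_0; case: (q4P p) => *; rewrite !q4E; congr q4; ring.
have qmul0r p : qmul p 0 = 0 :> 'rV[F]_4.
  by rewrite q4_0; case: (q4P p) => *; rewrite !q4E; congr q4; ring.
have qbar0 : qbar 0 = 0 :> 'rV[F]_4 by rewrite q4_0 !q4E oppr0.
have -> : g + h = (g.1 + h.1, g.2 (+) h.2) by [].
have [h' h'P] := qaxis_bar h.1 d.
rewrite /axis; case: g h h' h'P => [k []] [l []] /= h' h'P;
  rewrite emul_oct ?qbar0 ?qmul0l ?qmul0r ?h'P ?oppr0 ?sub0r ?subr0 ?addr0 ?add0r.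
- by have [s ->] := qaxisM l k h' c; exists (- s); rewrite qaxisN addrC.
- by have [s ->] := qaxisM k l c h'; exists s.
- by have [s ->] := qaxisM l k d c; exists s; rewrite addrC.
- by have [s ->] := qaxisM k l c d; exists s.
Qed.

Lemma unit_vec0 : unit_vec 0 = e1 F.
Proof. by rewrite /unit_vec /axis /= q4_0. Qed.

Lemma edot_unit_vec g h : edot (unit_vec g) (unit_vec h) = (g == h)%:R.
Proof.
case: g h => [[[] []] []] [[[] []] []]; rewrite /unit_vec /axis /= q4_0 edot_oct !qdot_q4;
  by rewrite ?mulr0 ?mulr1 ?addr0 ?add0r.
Qed.

Lemma unit_vec_span : spanning unit_vec.
Proof.
move=> W [W0 Wlin] Wbe u; case: (octP u) => a0 a1 a2 a3 b0 b1 b2 b3.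
have WZ c v : W v -> W (c *: v) by move=> Wv; rewrite -[_ *: _]addr0; apply: Wlin.
have -> : opair (q4 a0 a1 a2 a3) (q4 b0 b1 b2 b3) =
    a0 *: unit_vec (false, false, false) + (a1 *: unit_vec (true, false, false) +
    (a2 *: unit_vec (false, true, false) + (a3 *: unit_vec (true, true, false) +
    (b0 *: unit_vec (false, false, true) + (b1 *: unit_vec (true, false, true) +
    (b2 *: unit_vec (false, true, true) + b3 *: unit_vec (true, true, true))))))).
  by rewrite /unit_vec /axis /= q4_0 !octE !q4E; congr opair; congr q4; ring.
by do 7!apply: (Wlin _ _ _ (Wbe _)); apply: WZ; apply: Wbe.
Qed.

Definition unit_line g u : Prop := exists c, u = c *: unit_vec g.

Lemma unit_line_mul g h u v :
  unit_line g u -> unit_line h v -> unit_line (g + h) (emul u v).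
Proof.
case=> c -> [d ->]; rewrite emulZl emulZr.
by have [s ->] := axisM g h 1 1; exists (c * (d * s)); rewrite !axisZ mulr1 mulrA.
Qed.

Lemma unit_line_lin g : lin_closed (unit_line g).
Proof.
split=> [|c u v [a ->] [b ->]]; first by exists 0; rewrite scale0r.
by exists (c * a + b); rewrite scalerDl scalerA.
Qed.

End UnitGrading.

(** * The grading of the split octonions by Z/3 *)

Section Eigengrading.
Variable F : fieldType.
Hypothesis two_neq0 : (2 : F) != 0.
Variable i : F.
Hypothesis ii : i ^+ 2 = -1.
Local Notation E := 'rV[F]_(4 + 4).
Local Notation u := (ei F).
Implicit Types (v w x : E).

(** The piece of degree 0 of the grading by Z/3 is the centraliser of u = e_i,
    the plane spanned by 1 and u. Pieces 1 and 2 are the eigenspaces of left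
    multiplication by u on the complement of that plane. *)
Definition centr_ei v : bool := emul u v == emul v u.

Lemma centr_eiP v : reflect (exists a b, v = a *: e1 F + b *: u) (centr_ei v).
Proof.
apply: (iffP eqP) => [|[a [b ->]]]; last first.
  by rewrite !(emulDl, emulDr, emulZl, emulZr) emul1l emul1r.
case: (octP v) => a0 a1 a2 a3 b0 b1 b2 b3.
have dbl0 (c : F) : 2 * c = 0 -> c = 0.
  by move/eqP; rewrite mulf_eq0 (negPf two_neq0) => /eqP.
have dbl0N (c : F) : - (2 * c) = 0 -> c = 0.
  by move/eqP; rewrite oppr_eq0 => /eqP/dbl0.
move/eqP; rewrite -subr_eq0 => /eqP.
have -> : emul u (opair (q4 a0 a1 a2 a3) (q4 b0 b1 b2 b3)) -
    emul (opair (q4 a0 a1 a2 a3) (q4 b0 b1 b2 b3)) u =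
    opair (q4 0 0 (- (2 * a3)) (2 * a2))
      (q4 (- (2 * b1)) (2 * b0) (2 * b3) (- (2 * b2))) by oct_ring.
have -> : 0 = opair 0 0 :> E by rewrite /opair row_mx0.
rewrite q4_0 => /eq_row_mx[].
case/q4_inj=> _ _ /dbl0N-> /dbl0-> /q4_inj[/dbl0N-> /dbl0-> /dbl0-> /dbl0N->].
by exists a0, a1; rewrite /e1 /ei !octE !q4E; congr opair; congr q4; ring.
Qed.

Lemma centr_ei_lin : lin_closed centr_ei.
Proof.
split=> [|c v w /eqP uv /eqP uw]; rewrite /centr_ei.
  by rewrite !(bilin0l, bilin0r) //; apply: emul_bilin.
by rewrite emulDl emulDr emulZl emulZr uv uw.
Qed.

Definition eig_ei (l : F) v : Prop :=
  [/\ edot v (e1 F) = 0, edot v u = 0 & emul u v = l *: v].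

Lemma eig_lin l : lin_closed (eig_ei l).
Proof.
split=> [|c v w [v1 vu uv] [w1 wu uw]].
  by rewrite /eig_ei !edot0l scaler0 (bilin0r (@emul_bilin F)).
rewrite /eig_ei !edotDl !edotZl v1 w1 vu wu mulr0 addr0; split=> //.
by rewrite emulDr emulZr uv uw scalerDr !scalerA mulrC.
Qed.

Let u1 : edot u (e1 F) = 0. Proof. by oct_ring. Qed.
Let uu : edot u u = 1. Proof. by oct_ring. Qed.
Let bu : ebar u = - u. Proof. exact: ebar_pure. Qed.

Lemma eig_anticomm l v : eig_ei l v -> emul v u = - (l *: v).
Proof.
case=> v1 vu uv; have := ebar_mulK u v (e1 F).
rewrite !emul1r edotC vu mul0rn scale0r bu (ebar_pure v1) !emulNl uv => /eqP.
by rewrite -opprD oppr_eq0 addrC addr_eq0 => /eqP.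
Qed.

(** (u v, w) = - (v, u w), so l (v, w) = - l (v, w). *)
Lemma eig_isotropic l v w : l ^+ 2 = -1 ->
  eig_ei l v -> eig_ei l w -> edot v w = 0.
Proof.
move=> ll [_ _ uv] [_ _ uw].
have l_neq0 : l != 0.
  by apply: contra_eq_neq ll => ->; rewrite expr0n eq_sym oppr_eq0 oner_eq0.
have : edot (emul u v) w = edot v (emul (- u) w) by rewrite edot_mull bu.
rewrite emulNl edotNr uv uw edotZl edotZr => /eqP.
rewrite -addr_eq0 -mulr2n -mulr_natl !mulf_eq0 (negPf two_neq0) (negPf l_neq0) /=.
by move/eqP.
Qed.

Lemma eigZ l c v : eig_ei l v -> eig_ei l (c *: v).
Proof. by have [l0 lP] := eig_lin l => v_l; rewrite -[_ *: _]addr0; apply: lP. Qed.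

Lemma eig_mul_centr l v w : eig_ei l v -> centr_ei w -> eig_ei l (emul v w).
Proof.
move=> v_l /centr_eiP[a [b ->]].
rewrite emulDr !emulZr emul1r (eig_anticomm v_l) scalerN -scaleNr scalerA -scalerDl.
exact: eigZ.
Qed.

Lemma centr_mul_eig l v w : centr_ei w -> eig_ei l v -> eig_ei l (emul w v).
Proof.
move=> /centr_eiP[a [b ->]] v_l; have [_ _ uv] := v_l.
by rewrite emulDl !emulZl emul1l uv scalerA -scalerDl; apply: eigZ.
Qed.

Lemma centr_mul v w : centr_ei v -> centr_ei w -> centr_ei (emul v w).
Proof.
move=> /centr_eiP[a [b ->]] /centr_eiP[c [d ->]]; apply/centr_eiP.
exists (a * c - b * d), (a * d + b * c).
by rewrite /e1 /ei !octE !q4E; congr opair; congr q4; ring.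
Qed.

Let mulu_eig l m v w : eig_ei l v -> eig_ei m w ->
  emul u (emul v w) = - (m *: emul v w).
Proof.
case=> v1 vu _ [_ _ uw]; have := ebar_mulK u v w.
rewrite edotC vu mul0rn scale0r bu (ebar_pure v1) !emulNl uw emulZr => /eqP.
by rewrite -opprD oppr_eq0 addr_eq0 => /eqP.
Qed.

Lemma eig_mul_eig l v w : l ^+ 2 = -1 ->
  eig_ei l v -> eig_ei l w -> eig_ei (- l) (emul v w).
Proof.
move=> ll v_l w_l; have [v1 vu uv] := v_l; have [w1 wu uw] := w_l.
split; last by rewrite (mulu_eig v_l w_l) scaleNr.
  by rewrite edot_mull emul1r (ebar_pure v1) edotNr (eig_isotropic ll) ?oppr0.
rewrite edot_mulr (ebar_pure w1) emulNr uw edotNr edotZr.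
by rewrite (eig_isotropic ll v_l) ?mulr0 ?oppr0.
Qed.

Lemma eig_mul_eigN l v w :
  eig_ei l v -> eig_ei (- l) w -> centr_ei (emul v w).
Proof.
move=> v_l w_l; rewrite /centr_ei (mulu_eig v_l w_l) scaleNr opprK.
have [w1 wu _] := w_l; have := mulK_ebar w u v.
rewrite wu mul0rn scale0r bu (ebar_pure w1) !emulNr (eig_anticomm v_l) => /eqP.
by rewrite emulNl emulZl opprK addrC subr_eq0.
Qed.

Definition eig_piece (k : 'Z_3) v : Prop :=
  match val k with 0%N => centr_ei v | 1%N => eig_ei i v | _ => eig_ei (- i) v end.

Lemma eig_piece_mul (k l : 'Z_3) v w :
  eig_piece k v -> eig_piece l w -> eig_piece (k + l) (emul v w).
Proof.
have NiNi : (- i) ^+ 2 = -1 by rewrite sqrrN.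
case: k l => [[|[|[|k]]] // Hk] [[|[|[|l]]] // Hl]; rewrite /eig_piece /=.
- exact: centr_mul.
- exact: centr_mul_eig.
- exact: centr_mul_eig.
- exact: eig_mul_centr.
- exact: eig_mul_eig.
- exact: eig_mul_eigN.
- exact: eig_mul_centr.
- by move=> v_l w_l; apply: (eig_mul_eigN v_l); rewrite opprK.
- by move=> v_l w_l; rewrite -[i]opprK; apply: eig_mul_eig.
Qed.

Lemma eig_piece_lin k : lin_closed (eig_piece k).
Proof.
by case: k => [[|[|k]] Hk]; [apply: centr_ei_lin | apply: eig_lin | apply: eig_lin].
Qed.

(** t - l u t is the component of t in the l-eigenspace, up to a factor 2. *)
Definition eig_vec (g : bool * bool * bool) : E :=
  let t := unit_vec F (false, g.1.2, g.2) in
  t - (if g.1.1 then - i else i) *: emul u t.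

Definition eig_deg (g : bool * bool * bool) : 'Z_3 :=
  if g.1.2 || g.2 then if g.1.1 then 2%:R else 1 else 0.

Let uE : u = unit_vec F (true, false, false).
Proof. by rewrite /unit_vec /axis /= q4_0. Qed.

Let uK x : emul u (emul u x) = - x.
Proof. by rewrite -[emul _ _]opprK -emulNl -bu ebar_mulKv uu scale1r. Qed.

Lemma eig_vecP g : eig_piece (eig_deg g) (eig_vec g).
Proof.
have eig_sub l (b c : bool) : l ^+ 2 = -1 -> b || c ->
    eig_ei l (unit_vec F (false, b, c) - l *: emul u (unit_vec F (false, b, c))).
  set t := unit_vec F _ => ll bc.
  have t1 : edot t (e1 F) = 0.
    by rewrite -unit_vec0 edot_unit_vec; case: (b) (c) bc => [] [].
  have tu : edot t u = 0 by rewrite uE edot_unit_vec.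
  split.
  - by rewrite edotBl edotZl edot_mull bu emul1r edotNr t1 tu oppr0 mulr0 subr0.
  - rewrite edotBl edotZl tu sub0r -[u in edot _ u]emul1r edot_mul2l t1.
    by rewrite !mulr0 oppr0.
  - rewrite emulDr emulNr emulZr uK scalerN opprK scalerBr scalerA -expr2 ll.
    by rewrite scaleN1r opprK addrC.
rewrite /eig_deg /eig_vec; case: g => [[[] b] c] /=; case: ifP => bc.
- by apply: eig_sub; rewrite ?sqrrN.
- case: b c bc => [] [] // _; apply/centr_eiP; exists 1, i.
  by rewrite -/(unit_vec F 0) unit_vec0 emul1r scale1r scaleNr opprK.
- exact: eig_sub.
- case: b c bc => [] [] // _; apply/centr_eiP; exists 1, (- i).
  by rewrite -/(unit_vec F 0) unit_vec0 emul1r scale1r scaleNr.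
Qed.

Lemma eig_vec_span : spanning eig_vec.
Proof.
move=> W W_lin Wb; have [W0 WP] := W_lin; apply: (unit_vec_span W_lin).
have WZ c v : W v -> W (c *: v) by move=> Wv; rewrite -[_ *: _]addr0; apply: WP.
have i_neq0 : i != 0.
  by apply: contra_eq_neq ii => ->; rewrite expr0n eq_sym oppr_eq0 oner_eq0.
have W_t b c : W (unit_vec F (false, b, c)).
  set t := unit_vec F _.
  have -> : t = 2^-1 *: (1 *: eig_vec (false, b, c) + eig_vec (true, b, c)).
    rewrite /eig_vec /= -/t scale1r scaleNr opprK addrACA addNr addr0 -mulr2n.
    by rewrite -scaler_nat scalerA mulVf // scale1r.
  by apply: WZ; apply: WP; apply: Wb.
have W_ut b c : W (emul u (unit_vec F (false, b, c))).
  set t := unit_vec F _.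
  have -> : emul u t = i^-1 *: ((-1) *: eig_vec (false, b, c) + t).
    by rewrite /eig_vec /= -/t scaleN1r opprB subrK scalerA mulVf // scale1r.
  by apply: WZ; apply: WP; [apply: Wb | apply: W_t].
case=> [[[] b] c]; last exact: W_t.
have [s us] := axisM (true, false, false) (true, b, c) (1 : F) 1.
have -> : unit_vec F (true, b, c) = - s *: emul u (unit_vec F (false, b, c)).
  apply: oppr_inj; rewrite -uK {2}uE [X in emul u X]us -[s]mulr1 -axisZ emulZr.
  by rewrite scaleNr opprK mulr1.
by apply: WZ; apply: W_ut.
Qed.

End Eigengrading.

(** * Quadratically closed fields *)

Section QuadraticallyClosed.
Variable F : fieldType.
Hypothesis two_neq0 : (2 : F) != 0.
Local Notation E := 'rV[F]_(4 + 4).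

Lemma sqrt_exists (i : F) : i ^+ 2 = -1 ->
    (forall x : E, exists c, edot x x = c ^+ 2) ->
  forall a : F, exists c, a = c ^+ 2.
Proof.
move=> ii norm_square a.
(* a = ((a + 1) / 2) ^ 2 + (i (a - 1) / 2) ^ 2 *)
have [c cc] := norm_square
  (opair (q4 ((a + 1) / 2) (i * ((a - 1) / 2)) 0 0) (q4 0 0 0 0)).
exists c; rewrite -cc edot_oct !qdot_q4.
transitivity (((a + 1) / 2) ^+ 2 + i ^+ 2 * ((a - 1) / 2) ^+ 2); last by ring.
by rewrite ii; field.
Qed.

Hypothesis sqrtF : forall a : F, exists c, a = c ^+ 2.

(** On a finite set that contains a square root of each of its elements squaring
    is injective, which is absurd as soon as 1 and -1 are in the set. *)
Lemma long_uniq_seq m : exists s : seq F,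
  [/\ uniq s, 1 \in s, -1 \in s & (m <= size s)%N].
Proof.
have neq1N1 : (1 : F) != -1 by rewrite -addr_eq0 -(natrD _ 1 1).
elim: m => [|m [s [us s1 sN1 ms]]].
  by exists [:: 1; -1]; rewrite /= !inE !eqxx orbT neq1N1.
have [/allP ss|/allPn[a sa noroot]] :=
    boolP (all (fun a => a \in [seq c ^+ 2 | c <- s]) s).
  have usq : uniq [seq c ^+ 2 | c <- s].
    by apply: leq_size_uniq us ss _; rewrite size_map.
  have : nth 0 s (index 1 s) != nth 0 s (index (-1) s) by rewrite !nth_index.
  rewrite nth_uniq ?index_mem // -(nth_uniq 0 _ _ usq) ?size_map ?index_mem //.
  by rewrite !(nth_map 0) ?index_mem // !nth_index // sqrrN eqxx.
have [c ac] := sqrtF a; exists (c :: s); rewrite /= us !inE s1 sN1 !orbT.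
split=> //; rewrite andbT; apply: contra noroot => sc.
by rewrite ac; apply: map_f.
Qed.

Lemma nonroot_exists (q : {poly F}) : q != 0 -> exists a, q.[a] != 0.
Proof.
move=> q_neq0; have [s [us _ _ qs]] := long_uniq_seq (size q).
have [/allP qs0|/allPn[a _]] := boolP (all (root q) s); last by exists a.
have := max_poly_roots q_neq0 (introT allP qs0) us.
by rewrite ltnNge qs.
Qed.

End QuadraticallyClosed.

(** * Multilinear maps along a line *)

Section PolynomialFunctions.
Variable F : fieldType.
Local Notation E := 'rV[F]_(4 + 4).

Definition polyfun (f : F -> F) : Prop := exists q : {poly F}, forall l, f l = q.[l].

Lemma polyfunM f g : polyfun f -> polyfun g -> polyfun (fun l => f l * g l).
Proof. by case=> q fq [r gr]; exists (q * r) => l; rewrite hornerM fq gr. Qed.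

Lemma polyfunB f g : polyfun f -> polyfun g -> polyfun (fun l => f l - g l).
Proof. by case=> q fq [r gr]; exists (q - r) => l; rewrite hornerD hornerN fq gr. Qed.

Lemma polyfun_sum (I : finType) (f : I -> F -> F) :
  (forall i, polyfun (f i)) -> polyfun (fun l => \sum_i f i l).
Proof.
move=> pf; have [q fq] := fin_all_exists pf.
by exists (\sum_i q i) => l; rewrite horner_sum; apply: eq_bigr => i _.
Qed.

Definition polyvec (f : F -> E) : Prop := forall w, polyfun (fun l => edot (f l) w).

Lemma polyfun_edot f g : polyvec f -> polyvec g -> polyfun (fun l => edot (f l) (g l)).
Proof.
move=> pf pg; have [q fgq] : polyfun (fun l =>
    \sum_k edot (f l) (delta_mx 0 k) * edot (g l) (delta_mx 0 k)).
  by apply: polyfun_sum => k; apply: polyfunM.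
exists q => l; rewrite -fgq edot_sum.
by apply: eq_bigr => k _; rewrite !edot_delta.
Qed.

(** Expanding one entry at a time exhibits the polynomial. *)
Lemma mlin_line n (A : lmodType F) (M : ('I_n -> A) -> E) a d : mlin M ->
  polyvec (fun l => M (fun k => a k + l *: d k)).
Proof.
move=> mlinM w.
suff line m c : polyfun (fun l =>
    edot (M (fun k : 'I_n => if (k < m)%N then a k + l *: d k else c k)) w).
  have [q Mq] := line n a; exists q => l; rewrite -Mq.
  by congr edot; apply: mlinM.1 => k; rewrite ltn_ord.
elim: m c => [|m IHm] c.
  by exists (edot (M c) w)%:P => l; rewrite hornerC.
have [m_n|n_m] := ltnP m n; last first.
  have [q Mq] := IHm c; exists q => l; rewrite -Mq.
  congr edot; apply: mlinM.1 => k; have kn := leq_trans (ltn_ord k) n_m.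
  by rewrite kn ltnS (ltnW kn).
pose j := Ordinal m_n.
have [q Mq] := IHm (upd c j (a j)); have [r Mr] := IHm (upd c j (d j)).
exists (q + 'X * r) => l; rewrite hornerD hornerM hornerX -Mq -Mr.
pose g (k : 'I_n) := if (k < m)%N then a k + l *: d k else c k.
have upd_g x : M (upd g j x) =
    M (fun k : 'I_n => if (k < m)%N then a k + l *: d k else upd c j x k).
  apply: mlinM.1 => k; rewrite /upd /g.
  by case: (k =P j) => [->|//]; rewrite /= ltnn.
rewrite -!upd_g -edotZl -(mlinZ mlinM) -edotDl -(mlinD mlinM).
congr edot; apply: mlinM.1 => k; rewrite /upd /g ltnS leq_eqVlt.
have -> : (k == j) = (val k == m) by [].
by case: eqP => [km|//] /=; have -> : k = j by apply: val_inj.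
Qed.

End PolynomialFunctions.

(** * Pencils of octonions *)

Section PurePart.
Variable F : fieldType.
Local Notation E := 'rV[F]_(4 + 4).
Implicit Types x y : E.

Definition pure_part x : E := x - edot x (e1 F) *: e1 F.

Lemma pure_part_pure x : edot (pure_part x) (e1 F) = 0.
Proof. by rewrite edotBl edotZl edot11 mulr1 subrr. Qed.

Lemma pure_partP c x y : pure_part (c *: x + y) = c *: pure_part x + pure_part y.
Proof.
rewrite /pure_part edotDl edotZl scalerDl scalerBr opprD addrACA.
by rewrite !scalerA.
Qed.

Lemma pure_part_split x : x = edot x (e1 F) *: e1 F + pure_part x.
Proof. by rewrite addrC subrK. Qed.

Lemma edot_pure_part x y : edot (pure_part x) (pure_part y) =
  edot x y - edot x (e1 F) * edot y (e1 F).
Proof.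
rewrite {2}/pure_part edotBr edotZr pure_part_pure mulr0 subr0.
by rewrite edotBl edotZl (edotC (e1 F)).
Qed.

Lemma pure_part_id x : edot x (e1 F) = 0 -> pure_part x = x.
Proof. by rewrite /pure_part => ->; rewrite scale0r subr0. Qed.

Lemma pure_part_eq0 x : pure_part x = 0 -> x = edot x (e1 F) *: e1 F.
Proof. by move=> x0; rewrite {1}[x]pure_part_split x0 addr0. Qed.

(** The norm of the pure part is a nondegenerate binary quadratic form on the
    pencil of x and y, so it has two distinct zeros. The trace is not 0
    on the pencil, so it vanishes at one of these zeros at most. *)
Lemma parabolic_in_pencil (sqrtF : forall a : F, exists c, a = c ^+ 2)
    (two_neq0 : (2 : F) != 0) x y :
    edot x (e1 F) != 0 ->
    edot (pure_part x) (pure_part x) * edot (pure_part y) (pure_part y) !=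
      edot (pure_part x) (pure_part y) ^+ 2 ->
  exists s t, let z := s *: x + t *: y in
    [/\ edot z (e1 F) != 0, pure_part z != 0 &
        edot (pure_part z) (pure_part z) = 0].
Proof.
have dotE (u v : E) s t : edot (s *: u + t *: v) (s *: u + t *: v) =
    edot u u * s ^+ 2 + 2 * edot u v * s * t + edot v v * t ^+ 2.
  by rewrite !(edotDl, edotDr, edotZl, edotZr) (edotC v u); ring.
set u := pure_part x; set v := pure_part y => x1 gram.
have prE s t : pure_part (s *: x + t *: y) = s *: u + t *: v.
  by rewrite pure_partP -[t *: y]addr0 pure_partP {3}/pure_part edot0l scale0r
    subr0 addr0.
have trE s t : edot (s *: x + t *: y) (e1 F) = s * edot x (e1 F) + t * edot y (e1 F).
  by rewrite edotDl !edotZl.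
have {}dotE := dotE u v.
move: gram; set a := edot u u in dotE *; set b := edot u v in dotE *.
set c := edot v v in dotE * => gram.
have pr_neq0 s t : t != 0 -> s *: u + t *: v != 0.
  move=> t_neq0; apply: contra_neq gram => suv.
  have sa : s * a + t * b = 0.
    by rewrite -(edot0l u) -suv (edotDl (s *: u)) !edotZl (edotC v).
  have sb : s * b + t * c = 0.
    by rewrite -(edot0l v) -suv (edotDl (s *: u)) !edotZl.
  apply: (mulfI t_neq0); apply/eqP; rewrite -subr_eq0; apply/eqP.
  transitivity (a * (s * b + t * c) - b * (s * a + t * b)); first by ring.
  by rewrite sa sb !mulr0 subrr.
have [a0|a_neq0] := eqVneq a 0.
  exists 1, 0; rewrite /= prE trE scale1r scale0r addr0 mul1r mul0r addr0.
  split=> //; apply: contra_neq gram => u0.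
  by rewrite /b /a u0 !edot0l mul0r expr0n.
have [d bd] := sqrtF (b ^+ 2 - a * c).
have d_neq0 : d != 0.
  apply: contra_neq gram => d0; apply/eqP; rewrite eq_sym -subr_eq0 bd d0 expr0n.
  by [].
have root e : e ^+ 2 = d ^+ 2 ->
    a * (- b + e) ^+ 2 + 2 * b * (- b + e) * a + c * a ^+ 2 = 0.
  move=> ee; transitivity (a * (e ^+ 2 - (b ^+ 2 - a * c))); first by ring.
  by rewrite ee bd subrr mulr0.
have good e : e ^+ 2 = d ^+ 2 ->
    (- b + e) * edot x (e1 F) + a * edot y (e1 F) != 0 ->
    exists s t, let z := s *: x + t *: y in
    [/\ edot z (e1 F) != 0, pure_part z != 0 &
        edot (pure_part z) (pure_part z) = 0].
  move=> ee tr_neq0; exists (- b + e), a; rewrite /= prE trE dotE.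
  by split; [| exact: pr_neq0 | exact: root].
(* The two isotropic points differ, so the trace kills at most one of them. *)
have [tr0|] := eqVneq ((- b + d) * edot x (e1 F) + a * edot y (e1 F)) 0;
  last exact: good.
apply: (good (- d)); first by rewrite sqrrN.
have -> : (- b - d) * edot x (e1 F) + a * edot y (e1 F) =
  ((- b + d) * edot x (e1 F) + a * edot y (e1 F)) - 2 * d * edot x (e1 F) by ring.
by rewrite tr0 sub0r oppr_eq0 !mulf_neq0.
Qed.

End PurePart.

(** * The values of a multilinear polynomial on the standard octonions *)

Section AttainedValues.
Variable F : fieldType.
Hypothesis two_neq0 : (2 : F) != 0.
Local Notation E := 'rV[F]_(4 + 4).
Local Notation Z23 := (bool * bool * bool)%type.
Hypothesis norm_square : forall x : E, exists c, edot x x = c ^+ 2.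
Variables (n : nat) (p : napoly F n).
Hypotheses (n_gt0 : (0 < n)%N) (multi_p : multilinear p).
Implicit Types (x y u v : E) (f : {ffun 'I_n -> Z23}).

Local Notation M := (pev (@emul F) p).
Definition attained x : Prop := exists a, M a = x.

Let mlinM : mlin M := pev_mlin (@emul_bilin F) multi_p.

(** The set of values need not be closed under addition, except for values that
    differ in a single entry. *)
Lemma attained_pencil a i x y s t :
  attained (s *: M (upd a i x) + t *: M (upd a i y)).
Proof.
by exists (upd a i (s *: x + t *: y)); rewrite mlinM.2 (mlinZ mlinM).
Qed.

Lemma attainedZ c x : attained x -> attained (c *: x).
Proof.
case=> a <-; pose i := Ordinal n_gt0.
have := attained_pencil a i (a i) (a i) c 0.
by rewrite scale0r addr0 (mlin_upd_id mlinM).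
Qed.

Lemma attained0 : attained 0.
Proof.
by rewrite -(scale0r (M (fun=> 0))); apply: attainedZ; exists (fun=> 0).
Qed.

Lemma attained_aut A x : aut A -> attained x -> attained (x *m A).
Proof.
case=> mA _ _ [a <-]; exists (fun i => a i *m A).
rewrite (pev_morph (mulB := @emul F) (phi := mulmx^~ A)) // => c y z.
by rewrite mulmxDl scalemxAl.
Qed.

Lemma attained_conj r u v : u != 0 -> v != 0 -> edot u (e1 F) = 0 ->
    edot v (e1 F) = 0 -> edot u u = edot v v ->
  attained (r *: e1 F + u) -> attained (r *: e1 F + v).
Proof.
move=> u_neq0 v_neq0 u1 v1 uv.
have [A autA <-] := pure_conj two_neq0 norm_square u_neq0 v_neq0 u1 v1 uv.
have [_ A1 _] := autA => /(attained_aut autA).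
by rewrite mulmxDl -scalemxAl A1.
Qed.

Definition on_units f : E := M (fun k => unit_vec F (f k)).
Definition scalar_at f : bool := edot (on_units f) (e1 F) != 0.
Definition pure_at f : bool := pure_part (on_units f) != 0.

Lemma on_unitsP f : exists c, on_units f = c *: unit_vec F (\sum_k f k).
Proof.
apply: (pev_graded (I := Z23) (Gr := @unit_line F)) => //.
- by move=> g h x y; apply: unit_line_mul.
- by move=> g; case: (unit_line_lin F g).
- by move=> g c x y; case: (unit_line_lin F g) => _; apply.
- by move=> i; exists 1; rewrite scale1r.
Qed.

Lemma pure_part_unit_vec g c :
  g != 0 -> pure_part (c *: unit_vec F g) = c *: unit_vec F g.
Proof.
move=> g0; rewrite pure_part_id // edotZl -unit_vec0 edot_unit_vec.
by rewrite (negPf g0) mulr0.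
Qed.

Lemma pure_part_e1 c : pure_part (c *: e1 F) = 0.
Proof. by rewrite /pure_part edotZl edot11 mulr1 subrr. Qed.

Lemma scalar_atP f : scalar_at f -> exists2 c, c != 0 & on_units f = c *: e1 F.
Proof.
rewrite /scalar_at; have [c ->] := on_unitsP f; rewrite edotZl -unit_vec0 edot_unit_vec.
have [->|] := eqVneq (\sum_k f k) 0; last by rewrite mulr0 eqxx.
by rewrite mulr1 => c0; exists c.
Qed.

Lemma pure_atP f : pure_at f -> exists c,
  [/\ \sum_k f k != 0, c != 0 & on_units f = c *: unit_vec F (\sum_k f k)].
Proof.
rewrite /pure_at; have [c ->] := on_unitsP f.
have [->|g0] := eqVneq (\sum_k f k) 0.
  by rewrite unit_vec0 pure_part_e1 eqxx.
rewrite pure_part_unit_vec // => cb; exists c; split=> //.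
by apply: contraNneq cb => ->; rewrite scale0r.
Qed.

Lemma not_scalar_pure f : ~~ (scalar_at f && pure_at f).
Proof.
apply/negP=> /andP[/scalar_atP[c _ Mf]].
by rewrite /pure_at Mf pure_part_e1 eqxx.
Qed.

Lemma on_units_eq0 f : ~~ scalar_at f -> ~~ pure_at f -> on_units f = 0.
Proof.
rewrite /scalar_at /pure_at !negbK => /eqP T0 /eqP/pure_part_eq0.
by rewrite T0 scale0r.
Qed.

Lemma unit_vec_neq0 g : unit_vec F g != 0.
Proof.
apply: contra_eq_neq (edot_unit_vec F g g) => ->; rewrite edot0l eqxx.
by rewrite eq_sym oner_eq0.
Qed.

Lemma attained_anisotropic r g c d u : c != 0 -> g != 0 ->
    (forall s, attained (r *: e1 F + s *: (c *: unit_vec F g))) ->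
    edot u (e1 F) = 0 -> edot u u = d ^+ 2 -> d != 0 ->
  attained (r *: e1 F + u).
Proof.
move=> c0 g0 Im u1 uu d0.
have := Im (d / c); rewrite scalerA divfK //; apply: attained_conj => //.
- by rewrite scaler_eq0 negb_or d0 unit_vec_neq0.
- by apply: contra_neq d0 => u0; have /esym/eqP := uu; rewrite u0 edot0l expf_eq0 => /eqP.
- by rewrite edotZl -unit_vec0 edot_unit_vec (negPf g0) mulr0.
- by rewrite edotZl edotZr edot_unit_vec eqxx mulr1 uu.
Qed.

Section PureValues.
Variable f0 : {ffun 'I_n -> Z23}.
Hypothesis f0P : pure_at f0.

Lemma attained_pure_anisotropic u : edot u (e1 F) = 0 -> edot u u != 0 -> attained u.
Proof.
move=> u1 uu0; have [d uu] := norm_square u.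
have d0 : d != 0 by move: uu0; rewrite uu expf_eq0.
have [c [g0 c0 Mf]] := pure_atP f0P.
rewrite -[u]add0r -(scale0r (e1 F)).
apply: (attained_anisotropic c0 g0 _ u1 uu d0) => s.
by rewrite scale0r add0r -Mf; apply: attainedZ; eexists.
Qed.

(** The values on tuples homogeneous for the grading by Z/3 are homogeneous. If
    they all lay in the centraliser of e_i so would all values, but e_j is one.
    So some value lies in an eigenspace, and is pure and isotropic. *)
Lemma attained_nilpotent u : u != 0 -> edot u (e1 F) = 0 -> edot u u = 0 -> attained u.
Proof.
move=> u0 u1 uu; have [i ii] := isotropic_sqrtN1 norm_square u0 uu.
pose b := eig_vec i.
have graded (f : {ffun 'I_n -> Z23}) :
    eig_piece i (\sum_k eig_deg (f k)) (M (fun k => b (f k))).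
  apply: (pev_graded (I := 'Z_3)) => //.
  - by move=> *; apply: eig_piece_mul.
  - by move=> g; case: (eig_piece_lin i g).
  - by move=> g c x y; case: (eig_piece_lin i g) => _; apply.
  - by move=> k; apply: eig_vecP.
have [/existsP[f Mf]|] := boolP [exists f : {ffun 'I_n -> Z23},
    ~~ centr_ei (M (fun k => b (f k)))].
  have [l ll [v1 vu ev]] : exists2 l, l ^+ 2 = -1 & eig_ei l (M (fun k => b (f k))).
    move: (graded f); rewrite /eig_piece; case: (val _) => [|[|m]].
    - by rewrite (negPf Mf).
    - by exists i.
    - by exists (- i); rewrite ?sqrrN.
  rewrite -[u]add0r -(scale0r (e1 F)).
  apply: (@attained_conj 0 (M (fun k => b (f k)))) => //.
  - apply: contraNneq Mf => ->; by case: (centr_ei_lin F).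
  - by rewrite uu (@eig_isotropic _ two_neq0 l).
  - by rewrite scale0r add0r; eexists.
rewrite negb_exists => /forallP all_centr.
have ej1 : edot (ej F) (e1 F) = 0 by oct_ring.
have ejej : edot (ej F) (ej F) = 1 by oct_ring.
have [a Ma] : attained (ej F).
  by apply: attained_pure_anisotropic; rewrite ?ejej ?oner_eq0.
have : centr_ei (ej F).
  rewrite -Ma; apply: (mlin_span mlinM (eig_vec_span two_neq0 ii) (centr_ei_lin F)) => f.
  by have := all_centr f; rewrite negbK.
rewrite /centr_ei => /eqP; rewrite /ei /ej !octE !q4E => /eq_row_mx[/q4_inj[_ _ _]].
rewrite !(mul0r, mulr0, mul1r, subr0, addr0, add0r, sub0r, mulr1) => /eqP.
by rewrite -addr_eq0 -mulr2n (negPf two_neq0).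
Qed.

Lemma attained_pure u : edot u (e1 F) = 0 -> attained u.
Proof.
move=> u1; have [->|u0] := eqVneq u 0; first exact: attained0.
have [|uu] := eqVneq (edot u u) 0; first exact: attained_nilpotent.
exact: attained_pure_anisotropic.
Qed.

Variable f1 : {ffun 'I_n -> Z23}.
Hypothesis f1P : scalar_at f1.

Lemma attained_scalar r : attained (r *: e1 F).
Proof.
have [c c0 Mf] := scalar_atP f1P.
by rewrite -(divfK c0 r) -scalerA -Mf; apply: attainedZ; eexists.
Qed.

(** A closest pair of a scalar-valued and a pure-valued tuple of units gives a
    plane of values which contains 1 and an imaginary unit. *)
Lemma attained_anisotropic_pure_part r u : edot u (e1 F) = 0 -> edot u u != 0 ->
  attained (r *: e1 F + u).
Proof.
move=> u1 uu0; have [d uu] := norm_square u.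
have d0 : d != 0 by move: uu0; rewrite uu expf_eq0.
have [f [g [fP gP [a [i [x [y [Mx My]]]]]]]] :=
  closest_pencil mlinM not_scalar_pure on_units_eq0 f1P f0P.
have [c c0 fc] := scalar_atP fP; have [b [h0 b0 gb]] := pure_atP gP.
apply: (attained_anisotropic b0 h0 _ u1 uu d0) => s.
have := attained_pencil a i x y (r / c) s.
by rewrite Mx My [X in _ *: X + _]fc [X in _ + _ *: X]gb (scalerA (r / c) c) divfK.
Qed.

Lemma pure_part_mlin : mlin (fun a => pure_part (M a)).
Proof.
split=> [a b ab|a i c x y]; first by rewrite (mlinM.1 _ _ ab).
by rewrite mlinM.2 pure_partP.
Qed.

(** The pure values on units do not all have the same degree g, for otherwise
    the image would lie in the plane of 1 and the unit of degree g. A closest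
    pair of tuples with pure values of degree g and of another degree then gives
    two orthogonal anisotropic pure parts in one slot. *)
Lemma independent_pure_pencil : exists a i x y,
  edot (pure_part (M (upd a i x))) (pure_part (M (upd a i x))) *
    edot (pure_part (M (upd a i y))) (pure_part (M (upd a i y))) !=
  edot (pure_part (M (upd a i x))) (pure_part (M (upd a i y))) ^+ 2.
Proof.
set g := \sum_k f0 k; pose P f := pure_at f && (\sum_k f k == g).
pose Q f := pure_at f && (\sum_k f k != g).
have P_f0 : P f0 by rewrite /P f0P /=.
have [f2 Q_f2] : exists f, Q f.
  apply/existsP; apply: contraT; rewrite negb_exists => /forallP noQ.
  pose W x := exists a b, x = a *: e1 F + b *: unit_vec F g.
  have W_lin : lin_closed W.
    split=> [|c x y [a [b ->]] [a' [b' ->]]].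
      by exists 0, 0; rewrite !scale0r addr0.
    exists (c * a + a'), (c * b + b').
    by rewrite !scalerDr !scalerDl !scalerA addrACA.
  have [h h0 hg] : exists2 h : Z23, h != 0 & h != g.
    have [->|g1] := eqVneq g (true, false, false); first by exists (false, true, false).
    by exists (true, false, false) => //; rewrite eq_sym.
  have [a Ma] : attained (unit_vec F h).
    by apply: attained_pure; rewrite -unit_vec0 edot_unit_vec (negPf h0).
  have [] : W (unit_vec F h).
    rewrite -Ma; apply: (mlin_span mlinM (@unit_vec_span F) W_lin) => f.
    have [pf|npf] := boolP (pure_at f).
      have [c [_ _ fc]] := pure_atP pf; exists 0, c; rewrite scale0r add0r.
      by have := noQ f; rewrite /Q pf /= negbK => /eqP <-.
    exists (edot (on_units f) (e1 F)), 0; rewrite scale0r addr0.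
    by apply: pure_part_eq0; apply/eqP; move: npf; rewrite negbK.
  move=> b [c unit_h]; have := edot_unit_vec F h h; rewrite eqxx {1}unit_h edotDl !edotZl.
  rewrite -unit_vec0 !edot_unit_vec (eq_sym 0) (negPf h0).
  rewrite (eq_sym g) (negPf hg) !mulr0 addr0.
  by move/esym/eqP; rewrite oner_eq0.
have PQ f : ~~ (P f && Q f) by rewrite /P /Q; case: (_ == g); rewrite ?andbF.
have M0 f : ~~ P f -> ~~ Q f -> pure_part (on_units f) = 0.
  rewrite /P /Q; case: (_ == g); rewrite ?andbT ?andbF //= => + +;
  by move=> *; apply/eqP; rewrite -[_ == _]negbK.
have [f [f' [/andP[pf /eqP fg] /andP[pf' f'g] [a [i [x [y [Mx My]]]]]]]] :=
  closest_pencil pure_part_mlin PQ M0 P_f0 Q_f2.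
exists a, i, x, y; rewrite Mx My -/(on_units f) -/(on_units f').
have [c [g0 c0 ->]] := pure_atP pf; have [d [g'0 d0 ->]] := pure_atP pf'.
rewrite !pure_part_unit_vec // !(edotZl, edotZr) !edot_unit_vec !eqxx fg.
rewrite (eq_sym g) (negPf f'g).
by rewrite !mulr0 expr0n !mulr1 !mulf_neq0.
Qed.

(** Nonvanishing of the trace and of the Gram determinant are open conditions:
    along a line that joins a pencil with nonzero Gram determinant to a tuple
    with nonzero trace, both are given by nonzero polynomials, and
    F is infinite. *)
Lemma attained_isotropic_pure_part r u : r != 0 -> u != 0 -> edot u (e1 F) = 0 ->
  edot u u = 0 -> attained (r *: e1 F + u).
Proof.
move=> r0 u0 u1 uu; have [i ii] := isotropic_sqrtN1 norm_square u0 uu.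
have sqrtF := sqrt_exists two_neq0 ii norm_square.
have [a [j [x [y gram]]]] := independent_pure_pencil.
pose b k := unit_vec F (f1 k).
pose m0 l := M (fun k => upd a j x k + l *: (b k - upd a j x k)).
pose m1 l := M (fun k => upd a j y k + l *: upd (fun k => b k - a k) j 0 k).
have [tr trP] : polyfun (fun l => edot (m0 l) (e1 F)) by apply: mlin_line.
have dot_poly (h k : F -> E) : polyvec h -> polyvec k ->
    polyfun (fun l => edot (pure_part (h l)) (pure_part (k l))).
  move=> ph pk; have [q qP] : polyfun (fun l =>
      edot (h l) (k l) - edot (h l) (e1 F) * edot (k l) (e1 F)).
    by apply: polyfunB; [apply: polyfun_edot | apply: polyfunM].
  by exists q => l; rewrite edot_pure_part qP.
have p0 : polyvec m0 by apply: mlin_line.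
have p1 : polyvec m1 by apply: mlin_line.
have [G GP] : polyfun (fun l =>
    edot (pure_part (m0 l)) (pure_part (m0 l)) *
    edot (pure_part (m1 l)) (pure_part (m1 l)) -
    edot (pure_part (m0 l)) (pure_part (m1 l)) *
    edot (pure_part (m0 l)) (pure_part (m1 l))).
  by apply: polyfunB; apply: polyfunM; apply: dot_poly.
have m00 : m0 0 = M (upd a j x).
  by apply: mlinM.1 => k; rewrite scale0r addr0.
have m10 : m1 0 = M (upd a j y).
  by apply: mlinM.1 => k; rewrite scale0r addr0.
have m01 : m0 1 = on_units f1.
  by apply: mlinM.1 => k; rewrite scale1r addrC subrK.
have tr0 : tr != 0.
  by apply: contraTneq f1P => tr0; rewrite /scalar_at -m01 trP tr0 horner0 eqxx.
have G0 : G != 0.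
  apply: contra_neq gram => G0; apply/eqP; rewrite -subr_eq0 expr2.
  by rewrite -m00 -m10 GP G0 horner0.
have [l] := nonroot_exists two_neq0 sqrtF (mulf_neq0 tr0 G0).
rewrite hornerM mulf_eq0 negb_or -trP -GP subr_eq0 -expr2 => /andP[tr_l G_l].
have [s [t []]] := parabolic_in_pencil sqrtF two_neq0 tr_l G_l.
set z := _ + _ => z1 zp zz.
have Iz : attained z.
  pose c k := a k + l *: (b k - a k).
  have -> : z = s *: M (upd c j (x + l *: (b j - x))) + t *: M (upd c j y).
    congr (_ *: _ + _ *: _); apply: mlinM.1 => k; rewrite /upd /c.
      by case: eqP => [->|].
    by case: eqP => _; rewrite ?scaler0 ?addr0.
  exact: attained_pencil.
have zE : (r / edot z (e1 F)) *: z =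
    r *: e1 F + (r / edot z (e1 F)) *: pure_part z.
  transitivity ((r / edot z (e1 F)) *: (edot z (e1 F) *: e1 F + pure_part z)).
    by rewrite -pure_part_split.
  by rewrite scalerDr scalerA divfK.
have := attainedZ (r / edot z (e1 F)) Iz; rewrite zE; apply: attained_conj => //.
- by rewrite scaler_eq0 negb_or zp mulf_neq0 ?invr_neq0.
- by rewrite edotZl pure_part_pure mulr0.
- by rewrite edotZl edotZr zz uu !mulr0.
Qed.

End PureValues.

Theorem attained_octonions :
  [\/ forall x, attained x <-> x = 0,
      forall x, attained x <-> exists c, x = c *: e1 F,
      forall x, attained x <-> edot x (e1 F) = 0
    | forall x, attained x].
Proof.
have span := mlin_span mlinM (@unit_vec_span F).
have [/existsP[f0 f0P]|] := boolP [exists f, pure_at f]; last first.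
  rewrite negb_exists => /forallP no_pure.
  have Im_scalar x : attained x -> exists c, x = c *: e1 F.
    case=> a <-; apply: (span (fun x => exists c, x = c *: e1 F)) => [|f].
      split=> [|c u v [d ->] [e ->]]; first by exists 0; rewrite scale0r.
      by exists (c * d + e); rewrite scalerDl scalerA.
    exists (edot (on_units f) (e1 F)); apply: pure_part_eq0; apply/eqP.
    by have := no_pure f; rewrite negbK.
  have [/existsP[f1 f1P]|] := boolP [exists f, scalar_at f].
    apply: Or42 => x; split=> [|[c ->]]; first exact: Im_scalar.
    exact: attained_scalar f1P c.
  rewrite negb_exists => /forallP no_scalar; apply: Or41 => x.
  split=> [[a <-]|->]; last exact: attained0.
  apply: (span (fun x => x = 0)) => [|f].
    by split=> // c u v -> ->; rewrite scaler0 addr0.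
  exact: on_units_eq0.
have [/existsP[f1 f1P]|] := boolP [exists f, scalar_at f]; last first.
  rewrite negb_exists => /forallP no_scalar; apply: Or43 => x.
  split=> [[a <-]|x1]; last exact: (attained_pure f0P x1).
  apply: (span (fun x => edot x (e1 F) = 0)) => [|f].
    split=> [|c u v u1 v1]; first by rewrite edot0l.
    by rewrite edotDl edotZl u1 v1 mulr0 addr0.
  by apply/eqP; have := no_scalar f; rewrite negbK.
apply: Or44 => x; rewrite [x]pure_part_split; set r := edot _ _; set u := pure_part x.
have u1 : edot u (e1 F) = 0 := pure_part_pure x.
have [u0|u_neq0] := eqVneq u 0; first by rewrite u0 addr0; apply: attained_scalar f1P r.
have [uu|uu] := eqVneq (edot u u) 0; last exact: (attained_anisotropic_pure_part f0P f1P).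
have [r0|r_neq0] := eqVneq r 0; last exact: (attained_isotropic_pure_part f0P f1P).
by rewrite r0 scale0r add0r; exact: (attained_pure f0P u1).
Qed.

End AttainedValues.

(** * Reduction to the standard octonions *)

Section Normalisation.
Variables (F : fieldType) (two_neq0 : (2 : F) != 0).
Variables (Q : falgType F) (x y : Q) (quatQ : quaternion_algebra x y).
Variables (alpha : F) (alpha_neq0 : alpha != 0).
Hypothesis squares : propertyP x y alpha.
Local Notation E := 'rV[F]_(4 + 4).

Let qbasis : basis_of fullv (qseq x y).
Proof.
case: quatQ => dimQ spanQ _ _ _.
by rewrite basisEdim spanQ subvv size_tuple dimQ.
Qed.

(** The expression in the quaternion basis is unique, which makes the
    coordinate definition of the conjugation computable. *)
Lemma qcoordE (k : 'I_4 -> F) i :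
  coord (qseq x y) i (k (inord 0) *: 1 + k (inord 1) *: x + k (inord 2) *: y +
    k (inord 3) *: (x * y)) = k i.
Proof.
rewrite -[RHS](coord_sum_free k i (basis_free qbasis)); congr coord.
rewrite !big_ord_recr big_ord0 /= add0r.
by congr (k _ *: _ + k _ *: _ + k _ *: _ + k _ *: _); apply: val_inj; rewrite /= inordK.
Qed.

Lemma qconjE (k0 k1 k2 k3 : F) :
  qconj x y (k0 *: 1 + k1 *: x + k2 *: y + k3 *: (x * y)) =
  k0 *: 1 - k1 *: x - k2 *: y - k3 *: (x * y).
Proof.
pose k (i : 'I_4) := [:: k0; k1; k2; k3]`_i.
have kE (i : nat) : (i < 4)%N -> k (inord i) = [:: k0; k1; k2; k3]`_i.
  by move=> lt_i; rewrite /k inordK.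
have := qcoordE k; rewrite !kE //= => coE.
by rewrite /qconj !coE !kE.
Qed.

Let qconj_x : qconj x y x = - x.
Proof.
have := qconjE 0 1 0 0.
by rewrite !(scale0r, scale1r, oppr0, add0r, addr0).
Qed.

Let qconj_y : qconj x y y = - y.
Proof.
have := qconjE 0 0 1 0.
by rewrite !(scale0r, scale1r, oppr0, add0r, addr0).
Qed.

Let qconj_1 : qconj x y 1 = 1.
Proof.
have := qconjE 1 0 0 0.
by rewrite !(scale0r, scale1r, oppr0, add0r, addr0).
Qed.

Let qconj_0 : qconj x y 0 = 0.
Proof.
have := qconjE 0 0 0 0.
by rewrite !(scale0r, scale1r, oppr0, add0r, addr0).
Qed.

Lemma in_alg_inj (a b : F) : a%:A = b%:A :> Q -> a = b.
Proof.
move/eqP; rewrite -subr_eq0 -scalerBl scaler_eq0 oner_eq0 orbF subr_eq0.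
by move/eqP.
Qed.

Let neg_square (z : Q) (a : F) : qconj x y z = - z -> z * z = a%:A ->
  exists c, - a = c ^+ 2.
Proof.
move=> zbar zz; have [c] := squares z 0.
rewrite /qnorm zbar mulNr zz qconj_0 mul0r scaler0 subr0 -scaleNr.
by move/in_alg_inj; exists c.
Qed.

(** Property P applied to (x, 0), (y, 0) and (0, 1). *)
Lemma standard_generators : exists c1 c2 c3 : F,
  [/\ c1 != 0, c2 != 0, c3 != 0 &
  [/\ x * x = - (c1 ^+ 2)%:A, y * y = - (c2 ^+ 2)%:A & alpha = - c3 ^+ 2]].
Proof.
case: quatQ => _ _ [a a0 xx] [b b0 yy] _.
have [c1 ac1] := neg_square qconj_x xx; have [c2 bc2] := neg_square qconj_y yy.
have [c3 alphac3] : exists c3, - alpha = c3 ^+ 2.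
  have [c] := squares 0 1; rewrite /qnorm mulr0 mulr1 qconj_1 sub0r -scaleNr.
  by move/in_alg_inj; exists c.
have sq_neq0 (c d : F) : d = c ^+ 2 -> d != 0 -> c != 0.
  by move=> ->; rewrite expf_eq0.
exists c1, c2, c3; rewrite -ac1 -bc2 -alphac3 opprK !scaleNr !opprK; split=> //.
- by apply: sq_neq0 ac1 _; rewrite oppr_eq0.
- by apply: sq_neq0 bc2 _; rewrite oppr_eq0.
- by apply: sq_neq0 alphac3 _; rewrite oppr_eq0.
Qed.

Variables c1 c2 c3 : F.
Hypotheses (c1_neq0 : c1 != 0) (c2_neq0 : c2 != 0) (c3_neq0 : c3 != 0).
Hypotheses (xx : x * x = - (c1 ^+ 2)%:A) (yy : y * y = - (c2 ^+ 2)%:A).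
Hypothesis alphaE : alpha = - c3 ^+ 2.

Let X : Q := c1^-1 *: x.
Let Y : Q := c2^-1 *: y.
Local Notation h := (quat 1 X Y (X * Y)).

Let mul_bilin : bilin (@GRing.mul Q).
Proof.
by split=> c u v w; [rewrite mulrDl scalerAl | rewrite mulrDr scalerAr].
Qed.

Let XX : X * X = - 1.
Proof.
rewrite -scalerAl -scalerAr scalerA xx scalerN scalerA -expr2 exprVn.
by rewrite mulVf ?scale1r // expf_neq0.
Qed.

Let YY : Y * Y = - 1.
Proof.
rewrite -scalerAl -scalerAr scalerA yy scalerN scalerA -expr2 exprVn.
by rewrite mulVf ?scale1r // expf_neq0.
Qed.

Let YX : Y * X = - (X * Y).
Proof.
have [_ _ _ _ xy] := quatQ.
by rewrite -!scalerAl -!scalerAr xy !scalerN opprK !scalerA mulrC.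
Qed.

Let hM p q : h p * h q = h (qmul p q).
Proof.
apply: (quatM mul_bilin); rewrite ?mul1r ?mulr1 //.
- by rewrite mulrA -(mulrA X) YX mulrN mulNr !mulrA XX mulN1r mulNr YY opprK.
- by rewrite mulrA YX mulNr -mulrA YY mulrN1 opprK.
- by rewrite -mulrA YY mulrN1.
- by rewrite -mulrA YX mulrN mulrA XX mulN1r opprK.
- by rewrite mulrA XX mulN1r.
Qed.

Let hE (p : 'rV[F]_4) : h p = qco p 0 *: 1 + (qco p 1 / c1) *: x +
  (qco p 2 / c2) *: y + (qco p 3 / (c1 * c2)) *: (x * y).
Proof.
by rewrite /quat /X /Y -scalerAl -scalerAr !scalerA invfM !mulrA.
Qed.

Let h_conj p : qconj x y (h p) = h (qbar p).
Proof.
by rewrite !hE qconjE /qbar !qco_q4 !mulNr !scaleNr.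
Qed.

Let h1 c : h (q4 c 0 0 0) = c%:A.
Proof. by rewrite /quat !qco_q4 !scale0r !addr0. Qed.

(** The second half is divided by a square root of - alpha, which turns
    the doubling parameter -1 into alpha. *)
Definition realise (v : E) : oct Q :=
  (h (lsubmx v), c3^-1 *: h (rsubmx v)).

Let realiseE p q : realise (opair p q) = (h p, c3^-1 *: h q).
Proof. by rewrite /realise row_mxKl row_mxKr. Qed.

Let realiseP c u v : realise (c *: u + v) = c *: realise u + realise v.
Proof.
rewrite -(opairK u) -(opairK v) octZ octD !realiseE !quatP.
congr pair.
by rewrite [LHS]scalerDr scalerA mulrC -scalerA.
Qed.

Let realiseM u v : realise (emul u v) = omul x y alpha (realise u) (realise v).
Proof.
rewrite -(opairK u) -(opairK v) emul_oct !realiseE /omul /=.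
rewrite -!quatZ !h_conj !hM -quatZ -!quatD.
case: (q4P (lsubmx u)) (q4P (rsubmx u)) (q4P (lsubmx v)) (q4P (rsubmx v)).
move=> ???? [] ???? [] ???? [] ????; rewrite !q4E alphaE.
by congr pair; congr (quat _ _ _ _ _); congr q4; field.
Qed.

Let realise_e1 c : realise (c *: e1 F) = c *: @oone F Q.
Proof.
rewrite /e1 octZ realiseE !q4E !mulr0 mulr1 h1 /quat !qco_q4 !scale0r !addr0 scaler0.
by rewrite /oone; congr pair; rewrite scaler0.
Qed.

Let realise_otr v : otr x y (realise v) = realise (edot v (e1 F) *: e1 F).
Proof.
rewrite -(opairK v) realise_e1 /otr /oconj realiseE /= h_conj.
case: (q4P (lsubmx v)) (q4P (rsubmx v)) => a0 a1 a2 a3 [] b0 b1 b2 b3.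
have -> : edot (opair (q4 a0 a1 a2 a3) (q4 b0 b1 b2 b3)) (e1 F) = a0 by oct_ring.
set p := q4 a0 _ _ _; set q := q4 b0 _ _ _.
transitivity ((2^-1 *: (h p + h (qbar p)),
               2^-1 *: (c3^-1 *: h q - c3^-1 *: h q)) : oct Q).
  by [].
rewrite subrr scaler0 -quatD -quatZ /p !q4E.
have -> : q4 (2^-1 * (a0 + a0)) (2^-1 * (a1 - a1)) (2^-1 * (a2 - a2))
  (2^-1 * (a3 - a3)) = q4 a0 0 0 0 by congr q4; field.
by rewrite h1; congr pair; rewrite scaler0.
Qed.

Let unrealise (b : oct Q) : E :=
  let co (i : nat) q := coord (qseq x y) (inord i) q in
  let half q := q4 (co 0%N q) (c1 * co 1%N q) (c2 * co 2%N q) (c1 * c2 * co 3%N q) in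
  opair (half b.1) (c3 *: half b.2).

Let unrealiseK b : realise (unrealise b) = b.
Proof.
have half q : h (q4 (coord (qseq x y) (inord 0) q) (c1 * coord (qseq x y) (inord 1) q)
    (c2 * coord (qseq x y) (inord 2) q) (c1 * c2 * coord (qseq x y) (inord 3) q)) = q.
  rewrite hE !qco_q4 [RHS](coord_basis qbasis (memvf q)).
  rewrite !big_ord_recr big_ord0 /= add0r.
  rewrite [c1 * coord _ _ _]mulrC [c2 * coord _ _ _]mulrC.
  rewrite [c1 * c2 * coord _ _ _]mulrC !mulfK ?mulf_neq0 //.
  by congr (_ *: _ + _ *: _ + _ *: _ + _ *: _); congr coord; apply: val_inj;
    rewrite /= inordK.
case: b => b1 b2; rewrite /unrealise realiseE quatZ !half /=.
by rewrite scalerA mulVf // scale1r.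
Qed.

(** Property P transported to the coordinates. *)
Lemma edot_square (v : E) : exists c, edot v v = c ^+ 2.
Proof.
have [c] := squares (h (lsubmx v)) (c3^-1 *: h (rsubmx v)).
rewrite -quatZ /qnorm !h_conj !hM -quatZ -quatN -quatD => hc; exists c.
apply: in_alg_inj; rewrite -hc -h1; congr (quat _ _ _ _ _).
case: (octP v) => a0 a1 a2 a3 b0 b1 b2 b3; rewrite row_mxKl row_mxKr.
by rewrite edot_oct !q4E alphaE; congr q4; field.
Qed.

Lemma ev_weval n (a : 'I_n -> oct Q) w :
  ev (omul x y alpha) a w = weval x y alpha a w.
Proof. by elim: w => //= u -> v ->. Qed.

Lemma Im_poly_realise n (p : napoly F n) (b : oct Q) :
  Im_poly x y alpha p b <-> exists2 v, attained p v & realise v = b.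
Proof.
have peval_realise a : peval x y alpha p (fun i => realise (a i)) =
    realise (pev (@emul F) p a).
  rewrite (pev_morph (mulB := omul x y alpha) p a realiseP realiseM).
  by apply: eq_bigr => w _; rewrite ev_weval.
split=> [[a <-]|[v [a <-] <-]]; last by exists (fun i => realise (a i)).
exists (pev (@emul F) p (fun i => unrealise (a i))); first by eexists.
rewrite -peval_realise; apply: eq_bigr => w _; rewrite -!ev_weval.
by congr (_ *: _); apply: ev_ext => i.
Qed.

Lemma image_of_generators (n : nat) (n_gt0 : (0 < n)%N) (p : napoly F n)
    (multi_p : multilinear p) :
  [\/ same_set (Im_poly x y alpha p) (@ozero F Q),
      same_set (Im_poly x y alpha p) (@oscalar F Q),
      same_set (Im_poly x y alpha p) (opure x y)
    | same_set (Im_poly x y alpha p) (@ofull F Q)].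
Proof.
have ImE := Im_poly_realise p.
have realise0 : realise 0 = 0.
  by have := realiseP (-1) 0 0; rewrite scaler0 addr0 scaleN1r addNr.
have one_neq0 : @oone F Q != 0.
  by apply/eqP=> -[/eqP]; rewrite oner_eq0.
have [Im|Im|Im|Im] := attained_octonions two_neq0 edot_square n_gt0 multi_p.
- apply: Or41 => b; split=> [/ImE[v /Im-> <-]|->]; first exact: realise0.
  by apply/ImE; exists 0; first exact/Im.
- apply: Or42 => b; split=> [/ImE[v /Im[c ->] <-]|[c ->]].
    by exists c; apply: realise_e1.
  by apply/ImE; exists (c *: e1 F); [apply/Im; exists c | apply: realise_e1].
- apply: Or43 => b; split=> [/ImE[v /Im v1 <-]|b_pure].
    by rewrite /opure realise_otr v1 scale0r realise0.
  apply/ImE; exists (unrealise b); last exact: unrealiseK.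
  apply/Im; move: b_pure; rewrite /opure -[b in otr _ _ b]unrealiseK realise_otr.
  by rewrite realise_e1 => /eqP; rewrite scaler_eq0 (negPf one_neq0) orbF => /eqP.
- apply: Or44 => b; split=> // _; apply/ImE; exists (unrealise b) => //.
Qed.

End Normalisation.

Theorem theorem3p4
  (F : fieldType) (charF : 2%N \notin [pchar F])
  (Q : falgType F) (x y : Q) (quatQ : quaternion_algebra x y)
  (alpha : F) (alpha_neq0 : alpha != 0)
  (squares : propertyP x y alpha)
  (n : nat) (n_gt0 : (0 < n)%N)
  (p : napoly F n) (multilin_p : multilinear p) :
  [\/ same_set (Im_poly x y alpha p) (@ozero F Q),
      same_set (Im_poly x y alpha p) (@oscalar F Q),
      same_set (Im_poly x y alpha p) (opure x y)
    | same_set (Im_poly x y alpha p) (@ofull F Q)].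
Proof.
have two_neq0 : (2 : F) != 0 by apply: contraNneq charF => two0; rewrite inE /= two0.
have [c1 [c2 [c3 [c1_neq0 c2_neq0 c3_neq0 [xx yy alphaE]]]]] :=
  standard_generators quatQ alpha_neq0 squares.
exact: (image_of_generators two_neq0 quatQ squares c1_neq0 c2_neq0 c3_neq0).
Qed.
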